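(* Let $X$ be a thick convex digital disk in $\mathbb{Z}^2$. Let $S$ be a minimal bounding curve for $X$. Let $p_0$ be a vertex of $hull(X)$. Let $A$ be a cold set for $(X,c_1)$. Then $p_0 \in A$.
   Context: Adjacencies in $\mathbb{Z}^2$: distinct points $(x_1,x_2)$, $(y_1,y_2)$ are $c_2$-adjacent if $|x_i-y_i|\le 1$ for $i=1,2$; they are $c_1$-adjacent if moreover they differ in exactly one coordinate. For $\kappa\in\{c_1,c_2\}$ and $X\subset\mathbb{Z}^2$: a $\kappa$-path of length $k$ is a sequence $x_0,\dots,x_k$ with consecutive points equal or $\kappa$-adjacent; a set is $\kappa$-connected if any two of its points are joined by a $\kappa$-path in it; $d_\kappa(x,y)$ is the minimal length of a $\kappa$-path in $X$ from $x$ to $y$. $f:X\to X$ is in $C(X,\kappa)$ (is $\kappa$-continuous) if $\kappa$-adjacent points have equal or $\kappa$-adjacent images. For $(X,\kappa)$ connected, $A\subset X$ is a cold set if every $f\in C(X,\kappa)$ with $f|_A=\mathrm{id}_A$ satisfies $d_\kappa(x,f(x))\le 1$ for all $x\in X$. A $c_2$-closed curve is a $c_2$-path $\{s_i\}_{i=0}^m$ with $s_0=s_m$ and $s_i\ne s_j$ whenever $0<|i-j|<m$. If $S\subset\mathbb{Z}^2$ is a $c_2$-closed curve such that $\mathbb{Z}^2\setminus S$ has two $c_1$-components, one finite and the other infinite, the finite one is denoted $Int(S)$ and the infinite one $Ext(S)$; then $D=S\cup Int(S)$ is a digital disk, $S$ is a bounding curve of $D$, and $Int(D)$ denotes $Int(S)$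 when $S$ is understood. A disk may have several bounding curves; $S$ is minimal if no bounding curve of $D$ has fewer points. A digital line segment is a ($c_1$- or $c_2$-)connected collinear set of more than one point of $\mathbb{Z}^2$; it is horizontal or vertical (axis-parallel) or has slope $\pm1$ (slanted). The edges (sides) of $S$ are the maximal digital line segments in $S$. If edges $E_1,E_2$ of $S$ satisfy $E_1\cap E_2=\{p\}$, the interior angle at the vertex $p$ is the angle formed by $E_1$, $E_2$ and $Int(S)$. Thickness: a digital disk $X$ is thick if for some bounding curve $S$ of $X$ the following hold. (i) For every maximal slanted segment $\sigma$ of $S$ and every $p\in\sigma$ that is not an endpoint of $\sigma$, $X$ is slant-thick at $p$: there is $c\in X$ that is $c_2$-adjacent but not $c_1$-adjacent to $p$, where $c$ is the diagonal neighbor of $p$ off $\sigma$ (in the direction perpendicular to $\sigma$) on the interior side of $\sigma$. (ii) For every vertex $p$ of a $90^\circ$ interior angle $\theta$ of $S$, $X$ is $90^\circ$-thick at $p$: there is $q\in Int(X)$, in the interior of $\theta$, such that if $\theta$ has axis-parallel sides then $q$ is $c_2$-adjacent but not $c_1$-adjacent to $p$, and if $\theta$ has slanted sides then $q$ is $c_1$-adjacent to $p$. (iii) For every vertex $p$ of a $135^\circ$ interior angle $\theta$ of $S$, $X$ is $135^\circ$-thick at $p$: there are $b,b'\in X$ in the interior of $\theta$ with $b$ $c_2$-adjacent but not $c_1$-adjacent to $p$, and $b'$ $c_1$-adjacent to $p$. Convexity: $hull(Y)$ is the convex hull of $Y$ in $\mathbb{R}^2$; when it is a polygonal disk, its vertices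 are the endpoints of its edges. A digital disk $X$ is (digitally) convex if it has a bounding curve $S$ such that the endpoints of the maximal line segments of $S$ are the vertices of $hull(X)\subset\mathbb{R}^2$. *)

(* Defs.v *)
From mathcomp Require Import all_boot all_order all_algebra.
From mathcomp Require Import all_classical all_reals all_analysis.

Set Implicit Arguments.
Unset Strict Implicit.
Unset Printing Implicit Defensive.

Import Order.TTheory GRing.Theory Num.Theory.
Import numFieldNormedType.Exports.

Local Open Scope classical_set_scope.
Local Open Scope ring_scope.

Definition pt : Type := (int * int)%type.

Inductive adjacency := c1 | c2.

Definition adj (k : adjacency) : rel pt := fun x y =>
  let near := [&& x != y, `|x.1 - y.1| <= 1 & `|x.2 - y.2| <= 1] in
  match k with
  | c1 => near && ((x.1 != y.1) (+) (x.2 != y.2))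
  | c2 => near
  end.

Definition adjeq (k : adjacency) : rel pt := fun x y => (x == y) || adj k x y.

Definition kpath (k : adjacency) (X : set pt) (x y : pt) (n : nat) : Prop :=
  exists p : seq pt, [/\ size p = n, path (adjeq k) x p, last x p = y
    & forall z, z \in x :: p -> X z].

Definition kjoined (k : adjacency) (X : set pt) (x y : pt) : Prop :=
  exists n, kpath k X x y n.

Definition kconnected (k : adjacency) (X : set pt) : Prop :=
  forall x y, X x -> X y -> kjoined k X x y.

(* The default value 0 is only returned when x and y are not joined in X. *)
Definition dist (k : adjacency) (X : set pt) (x y : pt) : nat :=
  xget 0%N [set n | kpath k X x y n /\
                    forall m, kpath k X x y m -> (n <= m)%N].

(* A self-map of X is given by a function on Z^2 whose values outside X are
   irrelevant. *)
Definition kcontinuous (k : adjacency) (X : set pt) (f : pt -> pt) : Prop :=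
  set_fun X X f /\
  forall x y, X x -> X y -> adj k x y -> adjeq k (f x) (f y).

Definition cold_set (k : adjacency) (X A : set pt) : Prop :=
  [/\ kconnected k X, A `<=` X
    & forall f : pt -> pt, kcontinuous k X f -> (forall x, A x -> f x = x) ->
        forall x, X x -> (dist k X x (f x) <= 1)%N].

Definition is_component (k : adjacency) (Y C : set pt) : Prop :=
  exists2 x, Y x & C = [set y | kjoined k Y x y].

(* The sequence s lists s_0, ..., s_(m-1); the final point s_m = s_0 is not
   repeated. *)
Definition closed_curve (s : seq pt) : Prop :=
  (0 < size s)%N /\ ucycle (adjeq c2) s.

(* The union of the finite components; when there is exactly one of them, this
   is the finite component itself. *)
Definition Int (s : seq pt) : set pt :=
  [set x | exists C, [/\ is_component c1 (~` [set` s]) C, finite_set C & C x]].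

Definition bounding_curve (s : seq pt) (X : set pt) : Prop :=
  [/\ closed_curve s,
      exists I E, [/\ finite_set I, infinite_set E
        & [set C | is_component c1 (~` [set` s]) C] = [set I; E]]
    & X = [set` s] `|` Int s].

Definition digital_disk (X : set pt) : Prop := exists s, bounding_curve s X.

(* The points of a closed curve s are counted by size s, since s is uniq. *)
Definition minimal_bounding_curve (s : seq pt) (X : set pt) : Prop :=
  bounding_curve s X /\ forall t, bounding_curve t X -> (size s <= size t)%N.

Definition collinear (E : set pt) : Prop :=
  exists a b c : int, (a, b) != (0, 0) /\
    forall x, E x -> a * x.1 + b * x.2 = c.

Definition digital_segment (E : set pt) : Prop :=
  [/\ kconnected c1 E \/ kconnected c2 E, collinear E
    & exists x y, [/\ E x, E y & x != y]].

(* The segments of a curve are made of consecutive points of that curve.  Two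
   points of a curve that are adjacent in the plane but not consecutive, such as
   the two neighbours of the corner of a rectangle, do not form a segment. *)
Definition curve_segment (s : seq pt) (E : set pt) : Prop :=
  digital_segment E /\ exists i n, E = [set` take n (rot i s)].

Definition edge (s : seq pt) (E : set pt) : Prop :=
  curve_segment s E /\
  forall F, curve_segment s F -> E `<=` F -> F = E.

Definition axis_parallel (E : set pt) : Prop :=
  (forall x y, E x -> E y -> x.1 = y.1) \/
  (forall x y, E x -> E y -> x.2 = y.2).

Definition slanted (E : set pt) : Prop :=
  forall x y, E x -> E y -> `|x.1 - y.1| = `|x.2 - y.2|.

Definition endpoint (E : set pt) (p : pt) : Prop :=
  E p /\ forall d : pt, d != 0 -> ~ (E (p + d) /\ E (p - d)).

Notation plane R := (R^o * R^o)%type.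

Section Plane.
Variable R : realType.
Local Notation plane := (plane R).

Definition emb (p : pt) : plane := (p.1%:~R, p.2%:~R).

Definition dot (u v : plane) : R := u.1 * v.1 + u.2 * v.2.

Definition angle (u v : plane) : R :=
  acos (dot u v / (Num.sqrt (dot u u) * Num.sqrt (dot v v))).

Definition segment (u v : plane) : set plane :=
  [set (1 - t) *: u + t *: v | t in [set t : R | 0 <= t <= 1]].

Definition hull (Y : set pt) : set plane :=
  smallest (@convex_set R plane) (emb @` Y).

(* [u, v] is an edge of the convex set H when it is the intersection of H with
   one of its supporting lines. *)
Definition hull_edge (H : set plane) (u v : plane) : Prop :=
  u != v /\ exists (a : plane) (c : R),
    [/\ a != 0, forall z, H z -> dot a z <= c
      & H `&` [set z | dot a z = c] = segment u v].

Definition hull_vertex (Y : set pt) (v : plane) : Prop :=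
  exists w, hull_edge (hull Y) v w.

Definition trace (s : seq pt) : set plane :=
  [set z | exists2 p, p \in s & segment (emb p) (emb (next s p)) z].

(* The region of the Euclidean plane enclosed by the polygon drawn by s.  It
   decides on which side of the edges of s the interior lies, including at
   points where every lattice point nearby is on s. *)
Definition inside (s : seq pt) (z : plane) : Prop :=
  ~ trace s z /\ bounded_set (connected_component (~` trace s) z).

Definition sector (p : pt) (E F : set pt) : set plane :=
  [set z | exists x y (a b : R), [/\ E x /\ x != p, F y /\ y != p, 0 < a, 0 < b
     & z = emb p + a *: emb (x - p) + b *: emb (y - p)]].

(* The edges E and F form at p an interior angle of th radians.  This covers
   angles smaller than pi, whose interior is the convex sector between E
   and F; a reflex interior angle never satisfies it. *)
Definition interior_angle (s : seq pt) (E F : set pt) (p : pt) (th : R) : Prop :=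
  [/\ edge s E /\ edge s F, E `&` F = [set p],
      forall x y, E x -> F y -> x != p -> y != p ->
        angle (emb (x - p)) (emb (y - p)) = th
    & \forall z \near emb p, sector p E F z -> inside s z].

Definition diagonal (p q : pt) : bool := adj c2 p q && ~~ adj c1 p q.

Definition slant_thick (s : seq pt) (X E : set pt) (p : pt) : Prop :=
  exists c, [/\ X c, diagonal p c,
    forall x, E x -> dot (emb (c - p)) (emb (x - p)) = 0
    & \forall e \near 0^'+, inside s (emb p + e *: emb (c - p))].

Definition right_thick (s : seq pt) (E F : set pt) (p : pt) : Prop :=
  exists q, [/\ Int s q, sector p E F (emb q),
    axis_parallel E /\ axis_parallel F -> diagonal p q
    & slanted E /\ slanted F -> adj c1 p q].

Definition obtuse_thick (X E F : set pt) (p : pt) : Prop :=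
  exists b b', [/\ X b, X b', sector p E F (emb b) /\ sector p E F (emb b'),
    diagonal p b & adj c1 p b'].

Definition thick (X : set pt) : Prop :=
  exists2 s, bounding_curve s X &
  [/\ forall E p, edge s E -> slanted E -> E p -> ~ endpoint E p ->
        slant_thick s X E p,
      forall E F p, interior_angle s E F p (pi / 2) -> right_thick s E F p
    & forall E F p, interior_angle s E F p (3 * pi / 4) ->
        obtuse_thick X E F p].

Definition convex_disk (X : set pt) : Prop :=
  exists2 s, bounding_curve s X &
  emb @` [set p | exists2 E, edge s E & endpoint E p] = [set v | hull_vertex X v].

End Plane.

(* Main.v *)
Require Import Defs.
From mathcomp Require Import all_boot all_order all_algebra zify ring lra.
From mathcomp Require Import all_classical all_reals all_analysis.

(* Let p be the vertex and suppose p is not in A.  It suffices to find q in X, not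
   c1-adjacent to p, that is c1-adjacent or equal to all c1-neighbours of p in X:
   the map sending p to q and fixing the other points is then continuous and
   contradicts coldness.  As p is extreme, no two of its neighbours are opposite,
   and the only hard case is that of two neighbours p + e1 and p + e2, where q
   must be p + e1 + e2.  Suppose this point is not in X, and take p = 0.

   A discrete Jordan argument (parity of the number of crossings of a ray) shows
   that among the steps {0, (-1, 1)}, {0, e2}, {e1, e2} an even number belong to
   any bounding curve.  On a bounding curve whose turning points are all extreme
   this leaves, up to symmetry, only the passage e2, e1, 0, (-1, 1); X then lies
   in y >= 0, meets y = 0 in {0, e1} only, and does not contain (2, 1).  These
   facts force the same passage on the bounding curve that witnesses thickness.
   Parity of crossings in the Euclidean plane shows that its 135 degree angle at 0
   is an interior angle, so thickness puts e1 + e2 in X after all. *)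

Set Implicit Arguments.
Unset Strict Implicit.
Unset Printing Implicit Defensive.

Import Order.TTheory GRing.Theory Num.Theory.
Import numFieldNormedType.Exports.

Local Open Scope classical_set_scope.
Local Open Scope ring_scope.

(** * Cyclic sequences *)

Lemma odd_count_addb (T : Type) (P Q : pred T) (s : seq T) :
  odd (count (fun u => P u (+) Q u) s) = odd (count P s) (+) odd (count Q s).
Proof. by elim: s => //= u s IH; rewrite !oddD IH; do 2!case: (_ u) => //=;
  rewrite ?addbN ?addNb //; do 2!case: odd. Qed.

Section Cycles.
Variable (T : eqType) (s : seq T).
Hypothesis Us : uniq s.
Implicit Types (u v w : T).

Lemma perm_map_next : perm_eq (map (next s) s) s.
Proof.
apply: uniq_perm => //.
  by rewrite map_inj_uniq //; apply: can_inj (prev_next Us).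
move=> v; apply/mapP/idP => [[u us ->]|vs]; first by rewrite mem_next.
by exists (prev s v); rewrite ?mem_prev ?next_prev.
Qed.

(** The successor map permutes [s], so [g] holds equally often at the points and at their
    successors. Adding such a coboundary to a crossing test thus leaves its parity unchanged. *)
Lemma odd_count_boundary (g : pred T) :
  odd (count (fun u => g u (+) g (next s u)) s) = false.
Proof.
rewrite odd_count_addb -[X in _ (+) odd X](count_map (next s) g).
by rewrite (permP perm_map_next) addbb.
Qed.

Lemma rot_traject u : u \in s ->
  exists i, rot i s = traject (next s) u (size s).
Proof.
move=> us; have [i t E] := rot_to us; exists i; rewrite E.
have : fcycle (next s) (u :: t).
  have nx v : next (u :: t) v = next s v by rewrite -E next_rot.
  have : fcycle (next (u :: t)) (u :: t) by apply: cycle_next; rewrite -E rot_uniq.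
  by rewrite (eq_cycle (e' := frel (next s))) // => v w; rewrite /= -nx.
rewrite /= rcons_path => /andP[/fpathP[n def_t] _].
by rewrite -(size_rot i s) E def_t /= size_traject.
Qed.

Lemma mem_iter_next u v : u \in s -> v \in s ->
  exists2 i, (i < size s)%N & v = iter i (next s) u.
Proof.
move=> us vs; have [i E] := rot_traject us.
move: vs; rewrite -(mem_rot i) E => /trajectP[j lt_j ->]; by exists j.
Qed.

Lemma iter_next_inj u i j : u \in s -> (i < size s)%N -> (j < size s)%N ->
  iter i (next s) u = iter j (next s) u -> i = j.
Proof.
move=> us li lj eq_ij; have [k E] := rot_traject us.
have U : uniq (traject (next s) u (size s)) by rewrite -E rot_uniq.
apply/eqP; rewrite -(nth_uniq u _ _ U) ?size_traject //.
by rewrite !nth_traject // eq_ij.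
Qed.

Lemma iter_next_last u : u \in s -> iter (size s).-1 (next s) u = prev s u.
Proof.
move=> us; have s0 : (0 < size s)%N by case: s us.
have pus : prev s u \in s by rewrite mem_prev.
have [i li E] := mem_iter_next us pus; rewrite E.
have [->|ni] := eqVneq i (size s).-1; first by [].
suff: i.+1 = 0 by [].
by apply: (iter_next_inj us); rewrite ?iterS -?E ?next_prev //; lia.
Qed.

Lemma next_closed u (P : pred T) : u \in s -> P u ->
  (forall v, v \in s -> P v -> P (next s v)) -> forall v, v \in s -> P v.
Proof.
move=> us Pu cl v /(mem_iter_next us)[i _ ->].
suff: iter i (next s) u \in s /\ P (iter i (next s) u) by case.
by elim: i => [|i [IH1 IH2]] //=; rewrite mem_next; split=> //; apply: cl.
Qed.

Lemma next_neq_prev u : (2 < size s)%N -> u \in s -> next s u != prev s u.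
Proof.
move=> s2 us; apply/eqP => E.
have sub : {subset s <= [:: u; next s u]}.
  apply: (next_closed (u := u)) => // [|v _]; first by rewrite inE eqxx.
  rewrite !inE => /orP[] /eqP ->; rewrite ?eqxx ?orbT //.
  by rewrite {1}E next_prev ?eqxx.
by have := uniq_leq_size Us sub; rewrite leqNgt s2.
Qed.

Lemma next_neq u : (1 < size s)%N -> u \in s -> next s u != u.
Proof.
move=> s1 us; apply/eqP => E.
have sub : {subset s <= [:: u]}.
  apply: (next_closed (u := u)) => // [|v _]; rewrite !inE // => /eqP ->.
  by rewrite E.
by have := uniq_leq_size Us sub; rewrite leqNgt s1.
Qed.

(** Unoriented, so that later statements are insensitive to reversing the curve. *)
Definition step u v := (next s u == v) || (next s v == u).

Lemma stepC u v : step u v = step v u.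
Proof. exact: orbC. Qed.

Lemma stepE u v : step u v = (v == next s u) || (v == prev s u).
Proof.
rewrite /step eq_sym; congr (_ || _).
by apply/eqP/eqP => [<-|->]; rewrite ?prev_next ?next_prev.
Qed.

(** A cycle of more than two points takes an unoriented step at most once, so parity detects whether
    it is taken. *)
Lemma odd_count_step u v : (2 < size s)%N -> u \in s ->
  odd (count (fun w =>
    (w == u) && (next s w == v) || (w == v) && (next s w == u)) s)
  = step u v.
Proof.
move=> s2 us.
have cnt a b : a \in s ->
    count (fun w => (w == a) && (next s w == b)) s = (next s a == b).
  move=> as_; case: eqVneq => [E|E].
    have -> : nat_of_bool true = count_mem a s by rewrite count_uniq_mem // as_.
    by apply: eq_count => w /=; case: eqVneq => //= ->; rewrite E eqxx.
  rewrite -[RHS]/(0%N) -(count_pred0 s); apply: eq_count => w /=.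
  by case: eqVneq => //= ->; apply: negbTE.
have dis : ~~ ((next s u == v) && (next s v == u)).
  apply/negP => /andP[/eqP E /eqP F].
  by have /eqP := next_neq_prev s2 us; apply; rewrite E -F prev_next.
have uv : v \notin s -> step u v = false.
  apply: contraNF; rewrite stepE => /orP[] /eqP ->;
  by rewrite ?mem_next ?mem_prev.
transitivity (odd (count (fun w => ((w == u) && (next s w == v)) (+)
    ((w == v) && (next s w == u))) s)).
  congr (odd _); apply: eq_in_count => w ws /=.
  case: (w =P u) => [->|_] /=; last by [].
  case: (u =P v) => [<-|_] /=; last by rewrite orbF addbF.
  by rewrite (negbTE (next_neq (ltnW s2) us)).
rewrite odd_count_addb cnt //.
have [vs|nvs] := boolP (v \in s).
  by rewrite cnt // /step; move: dis; do 2!case: eqP.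
have -> : count (fun w => (w == v) && (next s w == u)) s = 0%N.
  rewrite -(count_pred0 s); apply: eq_in_count => w ws /=.
  by case: eqP ws nvs => //= -> ->.
by rewrite (uv nvs); have /norP[/negbTE -> _] := negbT (uv nvs).
Qed.

End Cycles.

(** * Lattice points and the discrete parity of crossings *)

Lemma pt_eqE (x y : pt) : (x == y) = (x.1 == y.1) && (x.2 == y.2).
Proof. by case: x y => [a b] [c d]. Qed.

Lemma ptP (x y : pt) : x.1 = y.1 -> x.2 = y.2 -> x = y.
Proof. by case: x y => [a b] [c d] /= -> ->. Qed.

Lemma adjC k : symmetric (adj k).
Proof. by move=> x y; apply/idP/idP; case: k; rewrite /adj !pt_eqE; lia. Qed.

Lemma adjeqC k : symmetric (adjeq k).
Proof. by move=> x y; rewrite /adjeq adjC eq_sym. Qed.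

Lemma adjeq2E (x y : pt) :
  adjeq c2 x y = (`|x.1 - y.1| <= 1) && (`|x.2 - y.2| <= 1).
Proof. by rewrite /adjeq /adj pt_eqE; apply/idP/idP; lia. Qed.

Lemma adjeq2_next (s : seq pt) u : cycle (adjeq c2) s -> u \in s ->
  adjeq c2 u (next s u).
Proof. by move=> cs us; apply: next_cycle. Qed.

Ltac int_cases :=
  repeat (match goal with
    | |- context [@eq_op _ ?x ?y] => case: (@eqP _ x y) => ?
    | |- context [@Order.lt _ _ ?x ?y] => case: (ltP x y) => ?
    | |- context [@Order.le _ _ ?x ?y] => case: (leP x y) => ?
    end; rewrite /= ?andbF ?andbT ?orbF ?orbT ?addbF ?addbT //; try (exfalso; lia)).

Lemma neq_memP (s : seq pt) (z u : pt) : z \notin s -> u \in s ->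
  u.1 = z.1 -> u.2 = z.2 -> False.
Proof. by move=> zs us e1 e2; case/negP: zs; rewrite -(ptP e1 e2). Qed.

Lemma finite_box (M : nat) :
  finite_set [set z : pt | `|z.1| <= M%:Z /\ `|z.2| <= M%:Z].
Proof.
pose f (ij : nat * nat) : pt := (ij.1%:Z - M%:Z, ij.2%:Z - M%:Z).
apply: (@sub_finite_set _ _ (f @` (`I_((M + M).+1) `*` `I_((M + M).+1)))).
  move=> [x y] /= [hx hy]; exists (absz (x + M%:Z), absz (y + M%:Z)) => /=.
    by rewrite /setX /=; lia.
  by apply: ptP; rewrite /f /=; lia.
by apply: finite_image; apply: finite_setX; apply: finite_II.
Qed.

Lemma bounded_seq (s : seq pt) : exists M : nat,
  forall u : pt, u \in s -> `|u.1| < M%:Z /\ `|u.2| < M%:Z.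
Proof.
exists (\sum_(u <- s) (absz u.1 + absz u.2).+1)%N => u us.
rewrite (big_rem u us) /=; lia.
Qed.

(* [dcross z u v]: the unit step from u to v crosses the horizontal ray that
   runs to the right from z, raised by one half. *)
Definition dcross (z u v : pt) : bool :=
  [&& u.2 == z.2, v.2 == z.2 + 1 & z.1 < u.1]
  || [&& v.2 == z.2, u.2 == z.2 + 1 & z.1 < v.1].

Definition dparity (s : seq pt) (z : pt) : bool :=
  odd (count (fun u => dcross z u (next s u)) s).

Section DiscreteParity.
Variable s : seq pt.
Hypotheses (Us : uniq s) (Cs : cycle (adjeq c2) s).

Lemma dparity_step_h (a b : int) : (a, b) \notin s -> (a + 1, b) \notin s ->
  dparity s (a, b) = dparity s (a + 1, b).
Proof.
move=> h1 h2; congr (odd _); apply: eq_in_count => u us.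
have vs : next s u \in s by rewrite mem_next.
have /= h2u := neq_memP h2 us; have /= h2v := neq_memP h2 vs.
rewrite /dcross /=; int_cases.
Qed.

(** The two crossing tests differ by the coboundary of the part of row [b + 1] right of column [a]:
    a unit step between the two rows cannot change sides of that column without using one of the two
    points off the curve. *)
Lemma dparity_step_v (a b : int) : (a, b) \notin s -> (a, b + 1) \notin s ->
  dparity s (a, b) = dparity s (a, b + 1).
Proof.
move=> h1 h2; rewrite -[LHS]addbF.
rewrite -(odd_count_boundary Us (fun u => (u.2 == b + 1) && (a < u.1))).
rewrite -odd_count_addb; congr (odd _); apply: eq_in_count => u us.
have vs : next s u \in s by rewrite mem_next.
have /= h1u := neq_memP h1 us; have /= h1v := neq_memP h1 vs.
have /= h2u := neq_memP h2 us; have /= h2v := neq_memP h2 vs.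
have := adjeq2_next Cs us; rewrite adjeq2E => /andP[d1 d2].
rewrite /dcross /=; clear -d1 d2 h1u h1v h2u h2v; int_cases.
Qed.

Lemma dparity_adj (z w : pt) : z \notin s -> w \notin s -> adj c1 z w ->
  dparity s z = dparity s w.
Proof.
move: z w => [a b] [c d] hz hw; rewrite /adj pt_eqE /= => H.
have : (c = a + 1 /\ d = b \/ a = c + 1 /\ d = b) \/
  (c = a /\ d = b + 1 \/ c = a /\ b = d + 1) by lia.
by case=> -[] [E1 E2]; subst; [|symmetry| |symmetry];
  (apply: dparity_step_h || apply: dparity_step_v).
Qed.

(** A ray starting above, below or to the right of the curve meets nothing. One starting far to the
    left is crossed by every step between its two rows, and these are even in number. *)
Lemma dparity_finite : finite_set [set z | dparity s z].
Proof.
have [M hM] := bounded_seq s; apply: sub_finite_set (finite_box M) => z /= Dz.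
have: has (fun u => dcross z u (next s u)) s.
  by rewrite has_count; move: Dz; rewrite /dparity; case: count.
move=> /hasP[u us cu]; have vs : next s u \in s by rewrite mem_next.
have [u1 u2] := hM _ us; have [v1 v2] := hM _ vs.
have [zu zM] : z.1 < M%:Z /\ `|z.2| <= M%:Z.
  by case/orP: cu => /and3P[/eqP c1 /eqP c2 c3]; split; lia.
split=> //; have [lz|lz] := leP (- M%:Z) z.1; first by lia.
suff: dparity s z = false by rewrite Dz.
rewrite -(odd_count_boundary Us (fun u : pt => u.2 <= z.2)).
congr (odd _); apply: eq_in_count => w ws.
have ws' : next s w \in s by rewrite mem_next.
have [u1' _] := hM _ ws; have [v1' _] := hM _ ws'.
have := adjeq2_next Cs ws; rewrite adjeq2E => /andP[d1 d2].
have [lw lw'] : z.1 < (w : pt).1 /\ z.1 < (next s w : pt).1.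
  by clear -u1' v1' lz; split; lia.
rewrite /dcross lw lw'; clear -d1 d2; int_cases.
Qed.

(* Comparing the rays from (1, 1) and (-1, 0): the only unit steps that cross
   exactly one of them are the three below. *)
Lemma corner_parity : (2 < size s)%N -> (0, 0) \in s -> (1, 0) \in s ->
  (1, 1) \notin s -> dparity s (1, 1) = false -> dparity s (-1, 0) = false ->
  step s (0, 0) (-1, 1) (+) step s (0, 0) (0, 1) (+) step s (1, 0) (0, 1)
  = false.
Proof.
move=> s2 os e1s qs D1 D2.
pose t a b u := (u == a) && (next s u == b) || (u == b) && (next s u == a).
(* The coboundary of [g] lowers the ray from [(1, 1)] to the height of the ray from [(-1, 0)], where
   the crossed steps can be compared one by one. *)
pose g (u : pt) := (u.2 == 1) && (1 < u.1).
have : odd (count (fun u => t (0, 0) (-1, 1) u (+) t (0, 0) (0, 1) u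
    (+) t (1, 0) (0, 1) u (+) dcross (1, 1) u (next s u)
    (+) dcross (-1, 0) u (next s u) (+) (g u (+) g (next s u))) s) = false.
  rewrite -[RHS]/(odd 0) -(count_pred0 s); congr (odd _).
  apply: eq_in_count => u us.
  have vs : next s u \in s by rewrite mem_next.
  have /= qu := neq_memP qs us; have /= qv := neq_memP qs vs.
  have := adjeq2_next Cs us; rewrite adjeq2E => /andP[d1 d2].
  rewrite /t /g !pt_eqE /dcross /=; clear -d1 d2 qu qv; int_cases.
rewrite odd_count_addb odd_count_boundary // !odd_count_addb.
rewrite -/(dparity s (1, 1)) -/(dparity s (-1, 0)) D1 D2 !odd_count_step //.
by rewrite !addbF.
Qed.

End DiscreteParity.

(** * The corner of an extreme point *)

(* [filled_outer] replaces the connectedness of the exterior: a locally constant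
   test with finite support fails outside [X]. *)
Record filled (s : seq pt) (X : set pt) : Prop := Filled {
  filled_uniq : uniq s;
  filled_cycle : cycle (adjeq c2) s;
  filled_sub : forall z, z \in s -> X z;
  filled_finite : finite_set X;
  filled_inner : exists2 z, X z & z \notin s;
  filled_adj : forall z w, X z -> z \notin s -> adj c1 z w -> X w;
  filled_outer : forall f : pt -> bool,
    (forall z w, z \notin s -> w \notin s -> adj c1 z w -> f z = f w) ->
    finite_set [set z | f z] -> forall z, ~ X z -> f z = false }.

(** Extremality in integer form: a vanishing nonnegative combination of displacements from [p] gives
    positive weight to [p] alone. Integer weights on three points keep the corner arguments within
    integer arithmetic. *)
Definition extreme (X : set pt) (p : pt) : Prop :=
  X p /\ forall (x y z : pt) (a b c : int), X x -> X y -> X z ->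
    0 < a -> 0 <= b -> 0 <= c ->
    a * (x.1 - p.1) + b * (y.1 - p.1) + c * (z.1 - p.1) = 0 ->
    a * (x.2 - p.2) + b * (y.2 - p.2) + c * (z.2 - p.2) = 0 -> x = p.

(** The negated condition says that [v] is the midpoint of its two neighbours, so that the curve
    goes straight there. Convexity enters the proof through this property only. *)
Definition turns_at_extreme (s : seq pt) (X : set pt) : Prop :=
  forall v : pt, v \in s ->
    ~ ((next s v : pt).1 + (prev s v : pt).1 = v.1 + v.1 /\
       (next s v : pt).2 + (prev s v : pt).2 = v.2 + v.2) -> extreme X v.

Section ExtremeCorner.
Variable X : set pt.
Hypotheses (ext0 : extreme X (0, 0)) (Xe1 : X (1, 0)) (Xe2 : X (0, 1)).

Lemma corner_ext (x y z : pt) (a b c : int) : X x -> X y -> X z ->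
  0 < a -> 0 <= b -> 0 <= c -> x <> (0, 0) ->
  a * x.1 + b * y.1 + c * z.1 = 0 -> a * x.2 + b * y.2 + c * z.2 = 0 -> False.
Proof.
move=> Xx Xy Xz a0 b0 c0 nx e1 e2; apply: nx.
by apply: (proj2 ext0 x y z a b c) => //=; rewrite !subr0.
Qed.

Lemma corner_left (x : int) : x < 0 -> ~ X (x, 0).
Proof.
move=> x0 Xx; apply: (@corner_ext (x, 0) (1, 0) (0, 0) 1 (- x) 0) => //=;
  try exact: (proj1 ext0);
  by [lia | case; lia].
Qed.

Lemma corner_below (x : int) : x < 0 -> ~ X (0, x).
Proof.
move=> x0 Xx; apply: (@corner_ext (0, x) (0, 1) (0, 0) 1 (- x) 0) => //=;
  try exact: (proj1 ext0);
  by [lia | case; lia].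
Qed.

Lemma corner_anti (x : pt) : X x -> x <> (0, 0) -> ~ X (- x.1, - x.2).
Proof.
move=> Xx nx Xx'.
by apply: (@corner_ext x (- x.1, - x.2) x 1 1 0) => //=; lia.
Qed.

Lemma corner_nbr (n : pt) :
  ~ X (1, 1) -> X n -> `|n.1| <= 1 -> `|n.2| <= 1 -> n <> (0, 0) ->
  [\/ n = (1, 0), n = (0, 1), n = (1, -1) | n = (-1, 1)].
Proof.
move=> Xq; case: n => [a b] Xn /= ha hb n0.
have : a = -1 \/ a = 0 \/ a = 1 by lia.
have : b = -1 \/ b = 0 \/ b = 1 by lia.
case=> [?|[?|?]] [?|[?|?]]; subst.
- exfalso; apply: (@corner_ext (-1, -1) (1, 0) (0, 1) 1 1 1) => //.
- by case: (@corner_below (-1)).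
- by constructor 3.
- by case: (@corner_left (-1)).
- by case: n0.
- by constructor 1.
- by constructor 4.
- by constructor 2.
- by case: Xq.
Qed.

End ExtremeCorner.

Section Filled.
Variables (s : seq pt) (X : set pt).
Hypothesis F : filled s X.

Let Us := filled_uniq F.
Let Cs := filled_cycle F.

Lemma filled_next (v : pt) : v \in s -> (1 < size s)%N ->
  [/\ X (next s v), `|(next s v : pt).1 - v.1| <= 1,
      `|(next s v : pt).2 - v.2| <= 1 & next s v <> v].
Proof.
move=> vs s1; have := adjeq2_next Cs vs; rewrite adjeq2E => /andP[h1 h2].
split; last exact/eqP/next_neq.
- by apply: (filled_sub F); rewrite mem_next.
- by rewrite distrC.
- by rewrite distrC.
Qed.

Lemma filled_prev (v : pt) : v \in s -> (1 < size s)%N ->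
  [/\ X (prev s v), `|(prev s v : pt).1 - v.1| <= 1,
      `|(prev s v : pt).2 - v.2| <= 1 & prev s v <> v].
Proof.
move=> vs s1; have vs' : prev s v \in s by rewrite mem_prev.
have [_ h1 h2 h3] := filled_next vs' s1; rewrite next_prev // in h1 h2 h3.
by split; [exact: (filled_sub F) | rewrite distrC | rewrite distrC | move/esym].
Qed.

(** Until a walk along the row meets the curve, [filled_adj] keeps it in [X], and a finite set
    cannot contain the whole half-row. *)
Lemma filled_row (e : int) (z : pt) : e = 1 \/ e = -1 -> X z -> z \notin s ->
  exists k : nat, (z.1 + e * k.+1%:Z, z.2) \in s.
Proof.
move=> He Xz zs; apply: contrapT => H.
pose g (k : nat) : pt := (z.1 + e * k%:Z, z.2).
have gs k : X (g k) /\ g k \notin s.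
  elim: k => [|k [IH1 IH2]].
    by have -> : g 0%N = z by apply: ptP; rewrite /g /=; lia.
  split; last by apply/negP => gs; apply: H; exists k.
  apply: (filled_adj F IH1 IH2); rewrite /adj !pt_eqE /g /=.
  by case: He => ->; lia.
have : finite_set (g @^-1` X).
  apply: finite_preimage (filled_finite F) => i j _ _ [].
  by case: He => ->; lia.
suff -> : g @^-1` X = [set: nat] by exact: infinite_nat.
by apply/seteqP; split=> // k _; case: (gs k).
Qed.

Lemma filled_wide_row :
  exists u v : pt, [/\ u \in s, v \in s, u.2 = v.2 & u.1 + 2 <= v.1].
Proof.
have [z Xz zs] := filled_inner F.
have [k hk] := @filled_row 1 z (or_introl erefl) Xz zs.
have [l hl] := @filled_row (-1) z (or_intror erefl) Xz zs.
by exists (z.1 + -1 * l.+1%:Z, z.2), (z.1 + 1 * k.+1%:Z, z.2); split=> //=; lia.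
Qed.

Lemma filled_parity z : ~ X z -> dparity s z = false.
Proof.
apply: (filled_outer F) (dparity_finite Us Cs) z => z w; exact: dparity_adj.
Qed.

Lemma filled_notin z : ~ X z -> z \notin s.
Proof. by move=> Xz; apply/negP => /(filled_sub F). Qed.

Lemma filled_closed (P : pred pt) u : u \in s -> P u ->
  (forall v, v \in s -> P v -> P (next s v)) ->
  exists x y : pt, [/\ P x, P y, x.2 = y.2 & x.1 + 2 <= y.1].
Proof.
move=> us Pu cl; have := next_closed Us us Pu cl => sP.
have [x [y [xs ys e l]]] := filled_wide_row.
by exists x, y; split=> //; apply: sP.
Qed.

Section Corner.
Hypotheses (ext0 : extreme X (0, 0)) (Xe1 : X (1, 0)) (Xe2 : X (0, 1)).
Hypothesis Xq : ~ X (1, 1).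

Let X0 : X (0, 0) := proj1 ext0.

(** A point of [X] off the curve has all its [c1]-neighbours in [X], but [(0, 0)] lacks [(-1, 0)]
    and the other two points lack [(1, 1)]. *)
Lemma corner_mem : [/\ (0, 0) \in s, (1, 0) \in s & (0, 1) \in s].
Proof.
split; apply/negPn/negP => h.
- by apply: (@corner_left _ ext0 Xe1 (-1)) => //; apply: (filled_adj F X0 h).
- by apply: Xq; apply: (filled_adj F Xe1 h).
- by apply: Xq; apply: (filled_adj F Xe2 h).
Qed.

Lemma corner_size : (2 < size s)%N.
Proof.
have [h1 h2 h3] := corner_mem.
apply: (@uniq_leq_size _ [:: (0, 0); (1, 0); (0, 1)]) => // x.
by rewrite !inE => /or3P[] /eqP ->.
Qed.

Lemma corner_next :
  [\/ next s (0, 0) = (1, 0), next s (0, 0) = (0, 1),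
      next s (0, 0) = (1, -1) | next s (0, 0) = (-1, 1)].
Proof.
have [h0 _ _] := corner_mem.
have [Xn h1 h2 h3] := filled_next h0 (ltnW corner_size).
by apply: (corner_nbr ext0 Xe1 Xe2 Xq) => //; [move: h1|move: h2]; rewrite subr0.
Qed.

Lemma corner_prev :
  [\/ prev s (0, 0) = (1, 0), prev s (0, 0) = (0, 1),
      prev s (0, 0) = (1, -1) | prev s (0, 0) = (-1, 1)].
Proof.
have [h0 _ _] := corner_mem.
have [Xn h1 h2 h3] := filled_prev h0 (ltnW corner_size).
by apply: (corner_nbr ext0 Xe1 Xe2 Xq) => //; [move: h1|move: h2]; rewrite subr0.
Qed.

Lemma corner_steps :
  step s (0, 0) (-1, 1) (+) step s (0, 0) (0, 1) (+) step s (1, 0) (0, 1)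
  = false.
Proof.
have [h0 h1 _] := corner_mem.
apply: corner_parity => //; [exact: corner_size|exact: filled_notin| |].
  exact: filled_parity.
by apply: filled_parity; apply: (corner_left ext0 Xe1).
Qed.

(** Three pairwise consecutive points are closed under [next s], so they make up the whole curve,
    including the two distant points of [filled_wide_row]. *)
Lemma no_triangle a b c : step s a b -> step s b c -> step s a c ->
  a != b -> b != c -> a != c -> a \in s ->
  exists x y : pt, [/\ x \in [:: a; b; c], y \in [:: a; b; c], x.2 = y.2
    & x.1 + 2 <= y.1].
Proof.
move=> ab bc ac nab nbc nac as_.
have clo u v w : step s u v -> step s u w -> v != w -> next s u \in [:: v; w].
  rewrite !stepE // !inE => /orP[] /eqP ->; rewrite ?eqxx // => /orP[] /eqP ->;
  by rewrite ?eqxx ?orbT.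
apply: (filled_closed (P := mem [:: a; b; c]) as_); first by rewrite /= !inE eqxx.
move=> v vs /=; rewrite !inE => /or3P[] /eqP ->.
- by have := clo a b c ab ac nbc; rewrite !inE => ->; rewrite orbT.
- have := clo b a c; rewrite stepC => /(_ ab bc nac).
  by rewrite !inE => /orP[] ->; rewrite ?orbT.
- have := clo c a b; rewrite stepC => /(_ ac); rewrite stepC => /(_ bc nab).
  by rewrite !inE => /orP[] ->; rewrite ?orbT.
Qed.

End Corner.
End Filled.

Lemma step_next (s : seq pt) u : step s u (next s u).
Proof. by rewrite /step eqxx. Qed.

Lemma step_prev (s : seq pt) u : uniq s -> step s u (prev s u).
Proof. by move=> Us; rewrite stepE // eqxx orbT. Qed.

Section FilledCorner.
Variables (s : seq pt) (X : set pt).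
Hypothesis F : filled s X.
Hypotheses (ext0 : extreme X (0, 0)) (Xe1 : X (1, 0)) (Xe2 : X (0, 1)).
Hypothesis Xq : ~ X (1, 1).

Let Us := filled_uniq F.
Let X0 : X (0, 0) := proj1 ext0.
Let s2 : (2 < size s)%N := corner_size F ext0 Xe1 Xe2 Xq.
Let os : (0, 0) \in s := let: And3 h _ _ := corner_mem F ext0 Xe1 Xe2 Xq in h.
Let e1s : (1, 0) \in s := let: And3 _ h _ := corner_mem F ext0 Xe1 Xe2 Xq in h.
Let e2s : (0, 1) \in s := let: And3 _ _ h := corner_mem F ext0 Xe1 Xe2 Xq in h.

Lemma step_third u v w t : u \in s -> step s u v -> step s u w -> v != w ->
  step s u t -> t = v \/ t = w.
Proof.
move=> us; rewrite !stepE // => /orP[] /eqP -> /orP[] /eqP ->;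
rewrite ?eqxx // => _ /orP[] /eqP ->; by [left|right].
Qed.

Lemma corner_no_triangle : step s (0, 0) (1, 0) -> step s (0, 0) (0, 1) ->
  step s (1, 0) (0, 1) -> False.
Proof.
move=> h1 h2 h3.
have := no_triangle F (a := (1, 0)) (b := (0, 0)) (c := (0, 1)).
rewrite stepC => /(_ h1 h2 h3 isT isT isT e1s) [x [y []]].
by rewrite !inE => /or3P[] /eqP -> /or3P[] /eqP ->.
Qed.

(** The origin has no third consecutive point, so parity makes [(1, 0)] and [(0, 1)] consecutive
    too, which closes a triangle. *)
Lemma corner_not_straddled :
  step s (0, 0) (1, 0) -> step s (0, 0) (0, 1) -> False.
Proof.
move=> h1 h2; apply: corner_no_triangle => //.
have := corner_steps F ext0 Xe1 Xe2 Xq; rewrite h2.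
case h : (step s (0, 0) (-1, 1)) => /=; last by case: step.
by have [] := step_third os h1 h2 isT h.
Qed.

(** The hypotheses concern [X] and not the curve, so the result passes from the curve given by
    convexity to the one given by thickness. They leave [(1, 0)] only two possible neighbours, and
    parity then gives the third step. *)
Lemma strip_steps : (forall z, X z -> 0 <= z.2) ->
  (forall z, X z -> z.2 = 0 -> z = (0, 0) \/ z = (1, 0)) -> ~ X (2, 1) ->
  [/\ step s (0, 0) (1, 0), step s (1, 0) (0, 1) & step s (0, 0) (-1, 1)].
Proof.
move=> below row far.
have nbr n : X n -> `|n.1 - 1| <= 1 -> `|n.2 - 0| <= 1 -> n <> (1, 0) ->
    n = (0, 0) \/ n = (0, 1).
  case: n => a b Xn /= ha hb n1; have := below _ Xn; have := row _ Xn.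
  have : b = 0 \/ b = 1 \/ b < 0 by lia.
  case=> [E|[E|hlt]] /=; last by lia.
    by subst b; move=> /(_ erefl) [->|/n1] //; left.
  subst b; have : a = 0 \/ a = 1 \/ a = 2 by lia.
  by case=> [->|[?|?]]; subst => //; right.
have [Xn n1 n2 n3] := filled_next F e1s (ltnW s2).
have [Xp p1 p2 p3] := filled_prev F e1s (ltnW s2).
have /eqP np := next_neq_prev Us s2 e1s.
have sn := step_next s (1, 0); have sp := step_prev (1, 0) Us.
have [s10 s12] : step s (1, 0) (0, 0) /\ step s (1, 0) (0, 1).
  by case: (nbr _ Xn n1 n2 n3) sn => E; case: (nbr _ Xp p1 p2 p3) sp => E';
    rewrite ?E ?E' in np * => // h1 h2; split.
rewrite stepC in s10; split=> //.
have s02 : step s (0, 0) (0, 1) = false.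
  by apply/negP => /(corner_not_straddled s10).
by have := corner_steps F ext0 Xe1 Xe2 Xq; rewrite s02 s12; case: step.
Qed.

Section Turning.
Hypothesis tX : turns_at_extreme s X.
Hypothesis next0 : next s (0, 0) = (1, 0).

Let step1 : step s (0, 0) (1, 0).
Proof. by rewrite -next0 step_next. Qed.

(* The curve follows the x-axis from the origin to an extreme point (k, 0), so
   the rest of the curve cannot meet the axis and stays on one side of it. *)
Lemma corner_not_acute : prev s (0, 0) = (1, -1) -> False.
Proof.
move=> prev0; pose c i := iter i (next s) (0, 0) : pt.
have cs i : c i \in s by elim: i => // i IH; rewrite /c iterS mem_next.
have s0 : (0 < size s)%N by exact: ltnW (ltnW s2).
(* After a full turn the curve is back at the origin and not at [(size s, 0)], so there is a least
   [k] at which it stops advancing along the axis. *)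
have ex : exists k, c k.+1 != (k.+1%:Z, 0).
  exists (size s).-1; rewrite /c iterS iter_next_last // next_prev //.
have lk : (ex_minn ex < size s)%N.
  case: ex_minnP => k _ /(_ (size s).-1); rewrite /c iterS iter_next_last //.
  by rewrite next_prev // pt_eqE /=; lia.
move: lk; case: ex_minnP => k hk kmin lk.
have ck i : (i <= k)%N -> c i = (i%:Z, 0).
  case: i => [//|i li]; apply/eqP/negPn/negP => /kmin; lia.
have k0 : (0 < k)%N.
  by case: (k) hk => [|//]; rewrite /c /= next0 eqxx.
have kE : extreme X (c k).
  apply: tX => // -[]; rewrite -[next s (c k)]/(c k.+1).
  have -> : prev s (c k) = c k.-1.
    by rewrite -{1}(prednK k0) /c iterS prev_next.
  rewrite (ck k) // (ck k.-1) ?leq_pred // => e1 e2; case/eqP: hk;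
    apply: ptP => /=; last first.
    by move: e2 => /=; lia.
  by move: e1 => /=; lia.
have row x : X (x, 0) -> 0 <= x <= k%:Z.
  move=> Xx; rewrite !leNgt; apply/andP; split; apply/negP => lx.
    exact: (corner_left ext0 Xe1 lx Xx).
  (* For [x > k] the point [(k, 0)] lies strictly between the origin and [(x, 0)]; the weights
     express this. *)
  have := proj2 kE (x, 0) (0, 0) (0, 0) k%:Z (x - k%:Z) 0 Xx X0 X0.
  rewrite ck //= => H; have [] : (x, 0) = (k%:Z, 0) :> pt; last by lia.
  by apply: H; [lia|lia|lia|ring|ring].
have off i : (k < i < size s)%N -> (c i).2 <> 0.
  move=> /andP[ki im] c0; have := cs i; move: c0.
  case ci : (c i) => [x y] /= y0; rewrite y0 in ci * =>
    /(filled_sub F) /row /andP[x0 xk].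
  have e : c i = c (absz x).
    by rewrite ci (ck (absz x)); [apply: ptP => /=; lia|lia].
  have lx : (absz x < size s)%N by lia.
  have := iter_next_inj Us os im lx e; lia.
(* Walking backwards from the predecessor [(1, -1)], the height changes by at most one per step and
   vanishes nowhere after index [k], so it stays negative; yet [(0, 1)] occurs after index [k]. *)
have neg j : (k < (size s).-1 - j)%N -> (c ((size s).-1 - j)%N).2 < 0.
  elim: j => [|j IH] hj.
    by rewrite subn0 /c iter_next_last // prev0.
  set i := (_ - _.+1)%N in hj *; have ei : ((size s).-1 - j)%N = i.+1 by lia.
  rewrite ei in IH; have {}IH := IH (ltnW hj).
  have [_ _ d _] := filled_next F (cs i) (ltnW s2).
  rewrite -[next s (c i)]/(c i.+1) in d.
  have ci0 : (c i).2 <> 0 by apply: off; lia.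
  clear -d IH ci0; lia.
have [i im e2i] := mem_iter_next Us os e2s.
have [ik|ki] := leqP i k.
  by have := ck i ik; rewrite /c -e2i => -[].
have := neg ((size s).-1 - i)%N.
rewrite subKn; last by rewrite -ltnS prednK.
by move=> /(_ ki); rewrite /c -e2i.
Qed.

Lemma corner_prev_obtuse : prev s (0, 0) = (-1, 1).
Proof.
have [E|E|E|//] := corner_prev F ext0 Xe1 Xe2 Xq.
- by have /eqP[] := next_neq_prev Us s2 os; rewrite next0 E.
- case: corner_not_straddled => //.
  by have := step_prev (0, 0) Us; rewrite E.
- by case: (corner_not_acute E).
Qed.

(** The two places next to the origin are taken by [(1, 0)] and [(-1, 1)], so the second of the
    three steps is absent and parity forces the third. *)
Lemma corner_step12 : step s (1, 0) (0, 1).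
Proof.
have h := step_prev (0, 0) Us; rewrite corner_prev_obtuse in h.
have := corner_steps F ext0 Xe1 Xe2 Xq; rewrite h.
case h2 : (step s (0, 0) (0, 1)); last by case: step.
by case: (step_third os step1 h isT h2).
Qed.

Lemma corner_next1 : next s (1, 0) = (0, 1).
Proof.
have := corner_step12; rewrite stepE // => /orP[/eqP//|/eqP].
by rewrite -next0 prev_next.
Qed.

Lemma corner_extreme1 : extreme X (1, 0).
Proof.
apply: tX => // -[]; rewrite corner_next1.
by have -> : prev s (1, 0) = (0, 0) by rewrite -next0 prev_next.
Qed.

Let Xb : X (-1, 1).
Proof. by rewrite -corner_prev_obtuse; apply: (filled_sub F); rewrite mem_prev. Qed.

(** The lower half-plane is cut into three regions. The first two contradict extremality of the
    origin, using [(1, 0)] and [(-1, 1)] respectively together with [(0, 1)]; the last contradicts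
    extremality of [(1, 0)]. *)
Lemma strip_below z : X z -> 0 <= z.2.
Proof.
case: z => x y Xz /=; rewrite leNgt; apply/negP => y0.
have nz : (x, y) <> (0, 0) :> pt by case; lia.
have [x0|x0] := leP x 0.
  by apply: (corner_ext ext0 (a := 1) (b := - x) (c := - y) Xz Xe1 Xe2) => //=; lia.
have [xy|xy] := leP (x + y) 0.
  by apply: (corner_ext ext0 (a := 1) (b := x) (c := - x - y) Xz Xb Xe2) =>
    //=; lia.
have : (x, y) = (1, 0) :> pt.
  apply: (proj2 corner_extreme1 _ (0, 1) (0, 0) 1 (- y) (x - 1 + y)) => //=; lia.
by case; lia.
Qed.

Lemma strip_row z : X z -> z.2 = 0 -> z = (0, 0) \/ z = (1, 0).
Proof.
case: z => x y Xz /= y0; subst y.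
have [x0|x0] := ltP x 0; first by case: (corner_left ext0 Xe1 x0 Xz).
have [x1|x1] := leP x 1.
  by have [|] : x = 0 \/ x = 1; [lia|left; congr pair|right; congr pair].
have : (x, 0) = (1, 0) :> pt.
  apply: (proj2 corner_extreme1 _ (0, 0) (0, 0) 1 (x - 1) 0) => //=; lia.
by case; lia.
Qed.

(* If (2, 1) were in [X], the curve would pass from it to (1, 2), and the four
   neighbours of (1, 1) would enclose it. *)
Lemma strip_far : ~ X (2, 1).
Proof.
move=> X21.
have s21 : (2, 1) \in s.
  by apply/negPn/negP => h; apply: Xq; apply: (filled_adj F X21 h).
have nbr n : step s (2, 1) n -> X n -> `|n.1 - 2| <= 1 -> `|n.2 - 1| <= 1 ->
    n <> (2, 1) -> [\/ n = (1, 2), n = (2, 2), n = (3, 2) | n = (3, 1)].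
  case: n => a b st Xn /= ha hb n0.
  have := strip_below Xn; have := strip_row Xn => /= row b0.
  have : a = 1 \/ a = 2 \/ a = 3 by lia.
  have : b = 0 \/ b = 1 \/ b = 2 by lia.
  case=> [?|[?|?]]; subst.
  - case: (row erefl) => -[?]; subst; first by case.
    move=> _; move: st; rewrite stepC => st.
    have st0 : step s (1, 0) (0, 0) by rewrite stepC step1.
    by case: (step_third e1s st0 corner_step12 isT st).
  - by case=> [?|[?|?]]; subst; [case: Xq|case: n0|constructor 4].
  - by case=> [?|[?|?]]; subst; [constructor 1|constructor 2|constructor 3].
have enc : (1, 2) \notin s.
  apply/negP => s12; apply: (elimF eqP _ (erefl (1, 1) : (1, 1) = (1, 1) :> pt)).
  (* With all four neighbours of [(1, 1)] on the curve, the indicator of this point is locally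
     constant off the curve. *)
  apply: (filled_outer F (f := fun z : pt => z == (1, 1))) => //; last first.
    rewrite (_ : [set _ | _] = [set (1, 1)]); first exact: finite_set1.
    by apply/seteqP; split=> z /= /eqP.
  have key z w : z \notin s -> w \notin s -> adj c1 z w -> z == (1, 1) -> False.
    move=> zs ws a /eqP ?; subst z; case: w ws a => x y ws.
    rewrite /adj !pt_eqE /= => a; move/negP: ws; apply.
    have : (x = 1 /\ y = 0 \/ x = 0 /\ y = 1) \/ (x = 2 /\ y = 1 \/ x = 1 /\ y = 2).
      by lia.
    by case=> -[] [-> ->].
  move=> z w zs ws a; apply/idP/idP => [/(key z w zs ws a)//|].
  by rewrite adjC in a => /(key w z ws zs a).
have [Xn n1 n2 n3] := filled_next F s21 (ltnW s2).
have [Xp p1 p2 p3] := filled_prev F s21 (ltnW s2).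
have not12 n : n \in s -> n <> (1, 2) by move=> /[swap] ->; apply/negP.
have ns : next s (2, 1) <> (1, 2) by apply: not12; rewrite mem_next.
have ps : prev s (2, 1) <> (1, 2) by apply: not12; rewrite mem_prev.
have Hn := nbr _ (step_next _ _) Xn n1 n2 n3.
have Hp := nbr _ (step_prev _ Us) Xp p1 p2 p3.
(* No two of the remaining candidates are opposite, so the curve turns at [(2, 1)]. *)
have ext : extreme X (2, 1).
  apply: tX => //; case: Hn => E; [by case: (ns E)| | |];
  (case: Hp => E'; [by case: (ps E')| | |]); by rewrite E E' => -[].
have no x y z a b c : X x -> X y -> X z -> 0 < a -> 0 <= b -> 0 <= c ->
    a * (x.1 - 2) + b * (y.1 - 2) + c * (z.1 - 2) = 0 ->
    a * (x.2 - 1) + b * (y.2 - 1) + c * (z.2 - 1) = 0 -> x = (2, 1).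
  by move=> Xx Xy Xz *; apply: (proj2 ext x y z a b c).
(* Seen from [(2, 1)], the point [(3, 2)] is opposite to [(1, 0)], and the displacements of
   [(2, 2)], [(3, 1)] and [(1, 0)] add up to zero. Extremality thus leaves a single candidate for
   both neighbours. *)
have no32 : ~ X (3, 2).
  move=> X32; have [] // : (3, 2) = (2, 1) :> pt.
  by apply: (no (3, 2) (1, 0) (1, 0) 1 1 0).
have both : ~ (X (2, 2) /\ X (3, 1)).
  move=> [X22 X31]; have [] // : (2, 2) = (2, 1) :> pt.
  by apply: (no (2, 2) (3, 1) (1, 0) 1 1 1).
have /eqP np := next_neq_prev Us s2 s21.
case: Hn => E; [exact: ns| |by apply: no32; rewrite -E|];
(case: Hp => E'; [exact: ps| |by apply: no32; rewrite -E'|]);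
by [apply: np; rewrite E E'|apply: both; rewrite -E -E'].
Qed.

End Turning.
End FilledCorner.

(** * Bounding curves and lattice isometries *)

Lemma kjoined_refl k (Y : set pt) x : Y x -> kjoined k Y x x.
Proof. by move=> Yx; exists 0%N, [::]; split=> // z; rewrite inE => /eqP ->. Qed.

Lemma kjoined_end k (Y : set pt) x y : kjoined k Y x y -> Y y.
Proof. by move=> [n [p [_ _ <- h]]]; apply: h; rewrite mem_last. Qed.

Lemma kjoined_adj k (Y : set pt) x y z : kjoined k Y x y -> Y z -> adj k y z ->
  kjoined k Y x z.
Proof.
move=> [n [p [sp pp lp h]]] Yz a; exists n.+1, (rcons p z).
rewrite size_rcons sp rcons_path pp lp last_rcons /adjeq a orbT; split=> // w.
by rewrite -rcons_cons mem_rcons inE => /orP[/eqP ->|/h].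
Qed.

Lemma kjoined_invariant k (Y : set pt) (T : Type) (f : pt -> T) x y :
  (forall z w, Y z -> Y w -> adj k z w -> f z = f w) -> kjoined k Y x y ->
  f x = f y.
Proof.
move=> fE [n [p [_ pp <- h]]]; elim: p x pp h => //= z p IH x /andP[xz pp] h.
have hx : Y x by apply: h; rewrite inE eqxx.
have hz : Y z by apply: h; rewrite !inE eqxx orbT.
rewrite -(IH z pp) => [|w wp]; last by apply: h; rewrite inE wp orbT.
by case/orP: xz => [/eqP ->//|/fE]; apply.
Qed.

(** For [filled_outer]: a point outside [X] lies in the infinite component, where a locally constant
    test is constant, hence false if its support is finite. *)
Lemma bounding_curve_filled s X : bounding_curve s X -> filled s X.
Proof.
move=> [[s0 /andP[Cs Us]] [I [E [finI infE comps]]] XE].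
have compI : is_component c1 (~` [set` s]) I.
  by have : [set I; E] I; [left|rewrite -comps].
have compE : is_component c1 (~` [set` s]) E.
  by have : [set I; E] E; [right|rewrite -comps].
have IntE : Int s = I.
  apply/seteqP; split=> [z [C [Ccomp finC Cz]]|z Iz]; last by exists I.
  have : [set I; E] C by rewrite -comps.
  by case=> /= CE; subst C.
have XE' z : X z <-> z \in s \/ I z by rewrite XE IntE.
have Is z : I z -> z \notin s.
  case: compI => x _ -> /kjoined_end h; exact/negP.
split=> //.
- by move=> z zs; apply/XE'; left.
- by rewrite XE IntE finite_setU; split=> //; apply: finite_seq.
- case: (compI) => x xs IE; have Ix : I x by rewrite IE; apply: kjoined_refl.
  by exists x; [apply/XE'; right|exact: Is].
- move=> z w /XE'[->//|Iz _ a]; apply/XE'.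
  have [ws|ws] := boolP (w \in s); [by left|right].
  case: compI Iz => x _ -> /= h; apply: kjoined_adj h _ a; exact/negP.
- move=> f fE finf z Xz.
  have zs : (~` [set` s]) z by move=> zs; apply: Xz; apply/XE'; left.
  have zC := kjoined_refl c1 zs.
  have : [set I; E] [set y | kjoined c1 (~` [set` s]) z y].
    by rewrite -comps; exists z.
  case=> /= CE; first by case: Xz; apply/XE'; right; rewrite -CE.
  apply/negP => fz; apply: infE; apply: sub_finite_set finf => y.
  rewrite -CE /= => /(kjoined_invariant (f := f)) <- // u v us vs.
  by apply: fE; apply/negP.
Qed.

Lemma filled_rev s X : filled s X -> filled (rev s) X.
Proof.
case=> U C sub fin [z Xz zs] ad out; split=> //.
- by rewrite rev_uniq.
- by rewrite rev_cycle; under eq_cycle => x y do rewrite adjeqC.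
- by move=> w; rewrite mem_rev; apply: sub.
- by exists z; rewrite ?mem_rev.
- by move=> u v Xu; rewrite mem_rev; apply: ad.
- by move=> f fE; apply: out => u v us vs; apply: fE; rewrite mem_rev.
Qed.

Lemma turns_rev s X : uniq s -> turns_at_extreme s X ->
  turns_at_extreme (rev s) X.
Proof.
move=> Us tX v; rewrite mem_rev next_rev // prev_rev // => vs h.
by apply: tX => // -[h1 h2]; apply: h; split; rewrite addrC.
Qed.

(* Lattice isometry taking [o] to the origin; [w] exchanges the axes, [a] and
   [b] reverse them. *)
Definition frame (o : pt) (w a b : bool) (z : pt) : pt :=
  let x := if a then o.1 - z.1 else z.1 - o.1 in
  let y := if b then o.2 - z.2 else z.2 - o.2 in
  if w then (y, x) else (x, y).

Definition unframe (o : pt) (w a b : bool) (z : pt) : pt :=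
  let x := if w then z.2 else z.1 in
  let y := if w then z.1 else z.2 in
  (if a then o.1 - x else o.1 + x, if b then o.2 - y else o.2 + y).

Section Frame.
Variables (o : pt) (w a b : bool).
Local Notation T := (frame o w a b).
Local Notation T' := (unframe o w a b).

Lemma frameK : cancel T T'.
Proof.
move=> z; apply: ptP; rewrite /frame /unframe.
  by case: w; case: a; case: b => /=; lia.
by case: w; case: a; case: b => /=; lia.
Qed.

Lemma unframeK : cancel T' T.
Proof.
move=> z; apply: ptP; rewrite /frame /unframe.
  by case: w; case: a; case: b => /=; lia.
by case: w; case: a; case: b => /=; lia.
Qed.

Lemma adj_frame k x y : adj k (T x) (T y) = adj k x y.
Proof.
rewrite /adj (can_eq frameK) /frame.
by case: k; case: w; case: a; case: b => /=; apply/idP/idP; lia.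
Qed.

Lemma adjeq_frame k x y : adjeq k (T x) (T y) = adjeq k x y.
Proof. by rewrite /adjeq adj_frame (can_eq frameK). Qed.

Lemma mem_map_frame s z : (z \in map T s) = (T' z \in s).
Proof. by rewrite -{1}(unframeK z) (mem_map (can_inj frameK)). Qed.

Lemma filled_frame s X : filled s X -> filled (map T s) (T' @^-1` X).
Proof.
case=> U C sub fin [z Xz zs] ad out; split.
- by rewrite map_inj_uniq //; apply: can_inj frameK.
- by rewrite cycle_map; under eq_cycle => x y do rewrite /= adjeq_frame.
- by move=> u; rewrite mem_map_frame => /sub.
- by apply: finite_preimage fin => ? ? _ _; apply: (can_inj unframeK).
- by exists (T z); rewrite /preimage /= ?mem_map_frame frameK.
- move=> u v Xu; rewrite mem_map_frame.
  have -> : adj c1 u v = adj c1 (T' u) (T' v) by rewrite -[RHS]adj_frame !unframeK.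
  exact: ad.
- move=> f fE finf u Xu; rewrite -(unframeK u).
  apply: (out (f \o T)) => //= [u' v' us vs e|]; last first.
    by apply: finite_preimage finf => ? ? _ _; apply: (can_inj frameK).
  by apply: fE; rewrite ?mem_map_frame ?frameK ?adj_frame.
Qed.

Lemma extreme_frame X p : extreme X p -> extreme (T' @^-1` X) (T p).
Proof.
move=> [Xp ext]; split; first by rewrite /preimage /= frameK.
move=> x y z k l m Xx Xy Xz k0 l0 m0 h1 h2.
suff : T' x = p by move=> <-; rewrite unframeK.
apply: (ext (T' x) (T' y) (T' z) k l m) => //;
move: h1 h2; rewrite /frame /unframe; case: w; case: a; case: b => /= h1 h2;
by [rewrite -[RHS]h1; ring | rewrite -[RHS]h2; ring
  | apply: oppr_inj; rewrite oppr0 -[RHS]h1; ring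
  | apply: oppr_inj; rewrite oppr0 -[RHS]h2; ring].
Qed.

Lemma turns_frame s X : uniq s -> turns_at_extreme s X ->
  turns_at_extreme (map T s) (T' @^-1` X).
Proof.
move=> Us tX v; rewrite mem_map_frame -(unframeK v) frameK.
move: (T' v) => u us; rewrite (next_map (can_inj frameK)) //.
rewrite (prev_map (can_inj frameK)) // => h.
apply: extreme_frame; apply: tX => // -[h1 h2]; apply: h.
move: h1 h2; rewrite /frame; case: w; case: a; case: b => /=; lia.
Qed.

End Frame.

(** * Edges of a curve *)

Lemma filled_size s X : filled s X -> (2 < size s)%N.
Proof.
move=> F; have Us := filled_uniq F; rewrite ltnNge; apply/negP => s2.
have [u [v [us vs e l]]] := filled_wide_row F.
have uv : uniq [:: u; v] by rewrite /= inE andbT pt_eqE; lia.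
have sub : {subset [:: u; v] <= s} by move=> z; rewrite !inE => /orP[] /eqP ->.
have [_ sE] := uniq_min_size uv sub s2.
have [Xn n1 n2 n3] := filled_next F us (uniq_leq_size uv sub).
have : next s u \in s by rewrite mem_next.
by rewrite -sE !inE => /orP[] /eqP E; rewrite E in n1 n3 *; [|lia].
Qed.

Lemma curve_segment_step (s : seq pt) u : uniq s -> cycle (adjeq c2) s ->
  (1 < size s)%N -> u \in s ->
  exists i, take 2 (rot i s) = [:: u; next s u] /\
    curve_segment s [set` take 2 (rot i s)].
Proof.
move=> Us Cs s1 us; have [i E] := rot_traject Us us.
have E2 : take 2 (rot i s) = [:: u; next s u].
  by rewrite E; case: (size s) s1 => [|[|n]] //= _; rewrite take0.
exists i; split=> //; split; last by exists i, 2%N.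
rewrite E2; have nu := next_neq Us s1 us; have a := adjeq2_next Cs us.
split.
- right=> x y; rewrite /= !inE => hx hy; exists 1%N, [:: y].
  split=> //=; last by move=> z; rewrite !inE => /orP[] /eqP ->.
  by rewrite andbT; case/orP: hx => /eqP ->; case/orP: hy => /eqP ->;
    rewrite // ?(adjeqC _ (next s u)) // /adjeq eqxx.
- set v : pt := next s u in nu a *.
  exists (v.2 - u.2), (u.1 - v.1), ((v.2 - u.2) * u.1 + (u.1 - v.1) * u.2).
  split; first by move: nu; rewrite !pt_eqE /=; lia.
  by move=> x; rewrite /= !inE => /orP[] /eqP -> //; ring.
- by exists u, (next s u); rewrite /= !inE !eqxx orbT eq_sym.
Qed.

(** Among the segments containing the step, one of greatest length is maximal for inclusion, because
    any larger segment contains the step as well. *)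
Lemma edge_of_step (s : seq pt) u : uniq s -> cycle (adjeq c2) s ->
  (1 < size s)%N -> u \in s -> exists E, [/\ edge s E, E u & E (next s u)].
Proof.
move=> Us Cs s1 us.
pose P n := exists i, [/\ (n <= size s)%N, curve_segment s [set` take n (rot i s)],
  u \in take n (rot i s) & next s u \in take n (rot i s)].
have exP : exists n, `[< P n >].
  have [i [E C]] := curve_segment_step Us Cs s1 us.
  by exists 2%N; apply/asboolP; exists i; rewrite E !inE !eqxx orbT -E.
have ubP n : `[< P n >] -> (n <= size s)%N by move=> /asboolP[i []].
case: (ex_maxnP exP ubP) => n /asboolP[i [ns C un nn]] nmax.
exists [set` take n (rot i s)]; split=> //; split=> // G CG sub.
case: (CG) => _ [j [m GE]].
(* Taking more than [size s] points yields the whole curve, so the length can be capped; it then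
   counts the points. *)
have [m' [m's GE']] : exists m', (m' <= size s)%N /\ G = [set` take m' (rot j s)].
  have [le|lt] := leqP m (size s); first by exists m.
  by exists (size s); split=> //; rewrite GE !take_oversize ?size_rot // ltnW.
have m'n : (m' <= n)%N.
  apply: nmax; apply/asboolP; exists j; split=> //; first by rewrite -GE'.
    by have := sub _ un; rewrite GE'.
  by have := sub _ nn; rewrite GE'.
have [_ eqm] : (size (take n (rot i s)) = size (take m' (rot j s))) *
    (take n (rot i s) =i take m' (rot j s)).
  apply: uniq_min_size.
  - by rewrite take_uniq // rot_uniq.
  - by move=> z /sub; rewrite GE'.
  - by rewrite !size_takel ?size_rot.
by rewrite GE'; apply/seteqP; split=> z /=; rewrite eqm.
Qed.

(** A nonzero coordinate of [d] is a unit, which makes the multiplier an integer. *)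
Lemma unit_multiple (d e : pt) : `|d.1| <= 1 -> `|d.2| <= 1 -> d <> (0, 0) ->
  d.2 * e.1 = d.1 * e.2 -> exists j : int, e.1 = j * d.1 /\ e.2 = j * d.2.
Proof.
case: d e => [a b] [x y] /= ha hb d0.
have : a = -1 \/ a = 0 \/ a = 1 by lia.
have : b = -1 \/ b = 0 \/ b = 1 by lia.
case=> [?|[?|?]] [?|[?|?]]; subst => // h.
- by exists (- x); lia.
- by exists (- y); lia.
- by exists x; lia.
- by exists (- x); lia.
- by exists x; lia.
- by exists (- x); lia.
- by exists y; lia.
- by exists x; lia.
Qed.

Lemma line_proportional (a b : int) (d e : pt) : (a, b) != (0, 0) ->
  a * d.1 + b * d.2 = 0 -> a * e.1 + b * e.2 = 0 -> d.2 * e.1 = d.1 * e.2.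
Proof.
rewrite pt_eqE /= negb_and => /orP[a0|b0] hd he.
  apply: (mulfI a0); transitivity (d.2 * (a * e.1 + b * e.2) - b * d.2 * e.2).
    by ring.
  by rewrite he; transitivity ((a * d.1 + b * d.2) * e.2 - b * d.2 * e.2);
    [rewrite hd; ring|ring].
apply: (mulfI b0); transitivity ((a * d.1 + b * d.2) * e.1 - a * d.1 * e.1).
  by ring.
by rewrite hd; transitivity (d.1 * (a * e.1 + b * e.2) - a * d.1 * e.1);
  [rewrite he; ring|ring].
Qed.

(* Along the segment the curve leaves a turning point [v] in one direction only,
   so [v] is an end of every segment that contains [v] and its successor. *)
Lemma turn_endpoint (s : seq pt) E (v : pt) : uniq s -> cycle (adjeq c2) s ->
  (2 < size s)%N -> v \in s -> curve_segment s E -> E v -> E (next s v) ->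
  ~ ((next s v : pt).1 + (prev s v : pt).1 = v.1 + v.1 /\
     (next s v : pt).2 + (prev s v : pt).2 = v.2 + v.2) -> endpoint E v.
Proof.
move=> Us Cs s2 vs [[_ [a [b [c [ab line]]]] _] [i [n EE]]] Ev En turn.
have s1 := ltnW s2.
have mult (y : pt) : E y -> exists j : int,
    y.1 - v.1 = j * ((next s v : pt).1 - v.1) /\
    y.2 - v.2 = j * ((next s v : pt).2 - v.2).
  move=> Ey; have := adjeq2_next Cs vs; rewrite adjeq2E => /andP[h1 h2].
  apply: (@unit_multiple ((next s v : pt).1 - v.1, (next s v : pt).2 - v.2)
    (y.1 - v.1, y.2 - v.2)) => /=.
  - by rewrite distrC.
  - by rewrite distrC.
  - by move=> [e1 e2]; have /eqP[] := next_neq Us s1 vs; apply: ptP; lia.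
  apply: (@line_proportional a b
    ((next s v : pt).1 - v.1, (next s v : pt).2 - v.2) (y.1 - v.1, y.2 - v.2))
    => //=; rewrite !mulrBr.
    by have := line _ En; have := line _ Ev; lia.
  by have := line _ Ey; have := line _ Ev; lia.
pose l := take n (rot i s).
have memE z : E z <-> z \in l by rewrite EE.
have pl : sorted (frel (next s)) l.
  apply: take_sorted; case Er : (rot i s) => [//|x t].
  have nx y : next (x :: t) y = next s y by rewrite -Er next_rot.
  have : fcycle (next (x :: t)) (x :: t).
    by apply: cycle_next; rewrite -Er rot_uniq.
  rewrite /cycle rcons_path => /andP[+ _].
  by rewrite (eq_path (e' := frel (next s))) // => y z; rewrite /= -nx.
have Ul : uniq l by rewrite take_uniq // rot_uniq.
have ls z : z \in l -> z \in s by move/mem_take; rewrite mem_rot.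
split=> // d d0 [Ep Em].
have lv : v \in l by apply/memE.
have [l1 [l2 lE]] : exists l1 l2, l = l1 ++ v :: l2.
  by case/splitPr: lv => l1 l2; exists l1, l2.
(* If something precedes [v] in the list, it is the predecessor of [v], with multiplier 1, 0 or -1:
   it would be the successor, [v] itself, or the point opposite to the successor, which the turn
   excludes. *)
case/lastP: l1 lE => [|l1 w] lE; last first.
  have wv : next s w = v.
    move: pl; rewrite lE cat_rcons; case: l1 {lE} => [|x l1] /=.
      by case/andP => /eqP.
    by rewrite cat_path /= => /and3P[_ _ /andP[/eqP]].
  have Ew : E w by apply/memE; rewrite lE mem_cat mem_rcons inE eqxx.
  have wE : w = prev s v by rewrite -wv prev_next.
  have ws := ls _ ((memE w).1 Ew); rewrite wE in Ew ws.
  have [j [j1 j2]] := mult _ Ew.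
  have := adjeq2_next Cs ws; rewrite next_prev // adjeq2E => /andP[p1 p2].
  have := adjeq2_next Cs vs; rewrite adjeq2E => /andP[n1 n2].
  have /eqP nv := next_neq Us s1 vs; have /eqP np := next_neq_prev Us s2 vs.
  have /eqP pv := next_neq Us s1 ws; rewrite next_prev // in pv.
  have : j = 1 \/ j = 0 \/ j = -1.
    have [e1|e1] : (next s v : pt).1 - v.1 <> 0 \/ (next s v : pt).2 - v.2 <> 0.
    - have [e1|n1'] := eqVneq ((next s v : pt).1) v.1; last first.
        by left; apply/eqP; rewrite subr_eq0.
      by right=> /subr0_eq e2; apply: nv; apply: ptP.
    - by clear -n1 e1 p1 j1; nia.
    - by clear -n2 e1 p2 j2; nia.
  clear -j1 j2 np pv turn => -[jE|[jE|jE]]; subst j.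
  - by case: np; apply: ptP; lia.
  - by case: pv; apply: ptP; lia.
  - by case: turn; split; lia.
(* The multiplier changes by at most one per step and does not vanish, since [v] is not repeated;
   once positive, it stays positive. *)
have pos t (y : pt) (j : int) : path (frel (next s)) y t -> 1 <= j -> v \notin t ->
    y \in s -> {subset t <= l} -> y.1 - v.1 = j * ((next s v : pt).1 - v.1) ->
    y.2 - v.2 = j * ((next s v : pt).2 - v.2) ->
    forall z : pt, z \in y :: t -> exists j' : int, [/\ 1 <= j',
      z.1 - v.1 = j' * ((next s v : pt).1 - v.1) &
      z.2 - v.2 = j' * ((next s v : pt).2 - v.2)].
  elim: t y j => [|x t IH] y j /= pt1 j0 vt ys tl e1 e2 z.
    by rewrite inE => /eqP ->; exists j.
  rewrite inE => /orP[/eqP ->|zt]; first by exists j.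
  move: pt1 vt => /andP[/eqP yx pt2]; rewrite inE negb_or => /andP[vx vt].
  have Ex : E x by apply/memE/tl; rewrite inE eqxx.
  have [k [k1 k2]] := mult _ Ex.
  have := adjeq2_next Cs ys; rewrite yx adjeq2E => /andP[x1 x2].
  have /eqP nv := next_neq Us s1 vs.
  have kj : `|j - k| <= 1.
    have [d1|d1] : (next s v : pt).1 - v.1 <> 0 \/ (next s v : pt).2 - v.2 <> 0.
    - have [f1|n1'] := eqVneq ((next s v : pt).1) v.1; last first.
        by left; apply/eqP; rewrite subr_eq0.
      by right=> /subr0_eq f2; apply: nv; apply: ptP.
    - by clear -d1 e1 k1 x1; nia.
    - by clear -d1 e2 k2 x2; nia.
  have k0 : k <> 0.
    move=> kE; rewrite kE !mul0r in k1 k2; move/eqP: vx; apply.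
    by apply: ptP; apply/esym/subr0_eq.
  apply: (IH x k) => //; first by clear -kj k0 j0; lia.
  - by apply: ls; apply: tl; rewrite inE eqxx.
  - by move=> u ut; apply: tl; rewrite inE ut orbT.
rewrite /= in lE.
case: l2 lE => [|y t] lE.
  have : next s v \in l by apply/memE.
  by rewrite lE inE (negbTE (next_neq Us s1 vs)).
have yE : y = next s v by move: pl; rewrite lE /= => /andP[/eqP ->].
have off z : E z -> z <> v -> exists j : int, [/\ 1 <= j,
    z.1 - v.1 = j * ((next s v : pt).1 - v.1) &
    z.2 - v.2 = j * ((next s v : pt).2 - v.2)].
  move=> /memE; rewrite lE inE => /orP[/eqP -> //|zt _].
  move: Ul pl; rewrite lE /= inE negb_or => /andP[/andP[_ vt] _] /andP[_ pt1].
  apply: (pos t y 1 pt1) => //; rewrite ?yE ?mul1r ?mem_next //.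
  by move=> u ut; rewrite lE !inE ut !orbT.
have nd (u : pt) : u = v + d \/ u = v - d -> u <> v.
  move=> [->|->] /eqP; rewrite -subr_eq0.
    by rewrite addrAC subrr add0r (negbTE d0).
  by rewrite addrAC subrr add0r oppr_eq0 (negbTE d0).
(* Both [v + d] and [v - d] have positive multipliers, so the step leaving [v] would be zero. *)
have [j [j1 a1 a2]] := off _ Ep (nd _ (or_introl erefl)).
have [k [k1 b1 b2]] := off _ Em (nd _ (or_intror erefl)).
have /eqP nv := next_neq Us s1 vs.
apply: nv; rewrite /= in a1 a2 b1 b2; apply: ptP; clear -j1 a1 a2 k1 b1 b2; nia.
Qed.

(** * Vertices of the convex hull *)

Section Hull.
Variable R : realType.
Local Notation plane := (plane R).

Lemma planeP (u v : plane) : u.1 = v.1 -> u.2 = v.2 -> u = v.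
Proof. by case: u v => [a b] [c d] /= -> ->. Qed.

Lemma plane_coordE :
  ((forall (t : R) (u : plane), (t *: u).1 = t * u.1 :> R)
   * (forall (t : R) (u : plane), (t *: u).2 = t * u.2 :> R))
  * ((forall u v : plane, (u + v).1 = u.1 + v.1 :> R)
     * (forall u v : plane, (u + v).2 = u.2 + v.2 :> R))
  * ((forall u : plane, (- u).1 = - u.1 :> R)
     * (forall u : plane, (- u).2 = - u.2 :> R)).
Proof. by []. Qed.

Lemma emb_inj : injective (emb R).
Proof. by move=> x y [/intr_inj e1 /intr_inj e2]; apply: ptP. Qed.

Lemma sub_hull (Y : set pt) y : Y y -> @hull R Y (emb R y).
Proof. by move=> Yy C [_]; apply; exists y. Qed.

Lemma hull_min (Y : set pt) (C : set plane) : @convex_set R plane C ->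
  emb R @` Y `<=` C -> @hull R Y `<=` C.
Proof. by move=> cC YC z; apply. Qed.

Lemma hull_convex (Y : set pt) : @convex_set R plane (@hull R Y).
Proof.
move=> x y l /set_mem Hx /set_mem Hy; apply/mem_set => C CY.
by apply/set_mem; case: (CY) => cC _; apply: cC; apply/mem_set;
  [apply: Hx|apply: Hy].
Qed.

Lemma segment_start (u v : plane) : segment u v u.
Proof.
exists 0; first by rewrite /= lexx ler01.
by rewrite subr0 scale1r scale0r addr0.
Qed.

(** In a vanishing combination every point with nonzero weight must lie on the supporting line.
    There all displacements are nonnegative multiples of [w - v], so each term vanishes. *)
Lemma hull_vertex_extreme (X : set pt) (v : plane) : hull_vertex X v ->
  exists2 p, extreme X p & emb R p = v.
Proof.
move=> [w [vw [a [c [a0 sup face]]]]].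
have faceP z : @hull R X z -> dot a z = c ->
  exists2 t, 0 <= t & z = v + t *: (w - v).
  move=> Hz az; have : segment v w z by rewrite -face.
  case=> t /= /andP[t0 _] <-; exists t => //.
  by rewrite scalerBl scale1r scalerBr addrAC addrA.
have wv : (w - v == 0) = false by rewrite subr_eq0 eq_sym; apply/negbTE.
have [Hv av] : @hull R X v /\ dot a v = c.
  by have := segment_start v w; rewrite -face.
have [p Xp pv] : (emb R @` X) v.
  apply: contrapT => nXv.
  (* As an end of a face, [v] is not strictly between two other points of the hull, so removing it
     leaves a convex set; if [v] were not a point of [X], that set would still contain [X]. *)
  suff : @hull R X `<=` @hull R X `\ v by move=> /(_ v Hv) [_ /(_ erefl)].
  apply: hull_min; last first.
    move=> _ [x Xx <-]; split; first exact: sub_hull.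
    by move=> /= xv; apply: nXv; exists x.
  apply/convex_setW => x y /set_mem[Hx xv] /set_mem[Hy yv] k k0 k1.
  apply/mem_set; split.
    by apply/set_mem; apply: hull_convex; apply/mem_set.
  have -> : conv k x y = k%:num *: (x : plane) + (1 - k%:num) *: (y : plane) by [].
  move=> /= zv; have k1' : 0 < 1 - k%:num by rewrite subr_gt0.
  have [ax ay] : dot a x = c /\ dot a y = c.
    have ux := sup _ Hx; have uy := sup _ Hy.
    have : k%:num * (c - dot a x) + (1 - k%:num) * (c - dot a y) = 0.
      by rewrite -av -zv /dot !plane_coordE; ring.
    have nx : 0 <= k%:num * (c - dot a x) by rewrite mulr_ge0 ?subr_ge0 // ltW.
    have ny : 0 <= (1 - k%:num) * (c - dot a y) by rewrite mulr_ge0 ?subr_ge0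
      // ltW.
    move=> /eqP; rewrite paddr_eq0 // !mulf_eq0 !(gt_eqF k0) !(gt_eqF k1') /=.
    by rewrite !subr_eq0 => /andP[/eqP <- /eqP <-].
  have [s s0 xE] := faceP _ Hx ax; have [t t0 yE] := faceP _ Hy ay.
  have st : (k%:num * s + (1 - k%:num) * t) *: (w - v) = 0.
    transitivity (k%:num *: (x : plane) + (1 - k%:num) *: (y : plane) - v).
      by rewrite xE yE; apply: planeP; rewrite !plane_coordE; ring.
    by rewrite zv subrr.
  have ks : 0 <= k%:num * s by rewrite mulr_ge0 // ltW.
  have kt : 0 <= (1 - k%:num) * t by rewrite mulr_ge0 // ltW.
  move/eqP: st; rewrite scaler_eq0 wv orbF paddr_eq0 //.
  rewrite !mulf_eq0 (gt_eqF k0) /= => /andP[/eqP sE _].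
  by apply: xv; rewrite /= xE sE scale0r addr0.
exists p => //; split=> // x y z k l m Xx Xy Xz k0 l0 m0 e1 e2.
have sup' q : X q -> dot a (emb R q - v) <= 0.
  move=> Xq; have := sup _ (sub_hull Xq); rewrite -av /dot !plane_coordE -subr_ge0.
  by move=> h; rewrite -oppr_ge0; move: h; congr (is_true (0 <= _)); ring.
have ray q (n : int) : X q -> n%:~R * dot a (emb R q - v) = 0 ->
    0 <= n -> exists2 t : R, 0 <= t & n%:~R *: (emb R q - v) = t *: (w - v).
  move=> Xq /eqP; rewrite mulf_eq0 intr_eq0 => /orP[/eqP ->|/eqP aq] n0.
    by exists 0; rewrite ?scale0r.
  have aqc : dot a (emb R q) = c.
    by rewrite -av; apply/eqP; rewrite -subr_eq0 -aq; apply/eqP;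
      rewrite /dot !plane_coordE; ring.
  have [t t0 qE] := faceP _ (sub_hull Xq) aqc.
  exists (n%:~R * t); first by rewrite mulr_ge0 // ler0z.
  by rewrite -scalerA qE addrAC subrr add0r.
have comb : k%:~R *: (emb R x - v) + l%:~R *: (emb R y - v) +
    m%:~R *: (emb R z - v) = 0 :> plane.
  rewrite -pv; apply: planeP; rewrite !plane_coordE /=.
    by have := congr1 (intr : int -> R) e1; rewrite !rmorphD !rmorphM !rmorphB.
  by have := congr1 (intr : int -> R) e2; rewrite !rmorphD !rmorphM !rmorphB.
have [ax [ay az]] : k%:~R * dot a (emb R x - v) = 0 /\
    l%:~R * dot a (emb R y - v) = 0 /\ m%:~R * dot a (emb R z - v) = 0.
  have : - (k%:~R * dot a (emb R x - v)) + - (l%:~R * dot a (emb R y - v))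
      + - (m%:~R * dot a (emb R z - v)) = 0.
    have := congr1 (dot a) comb; rewrite /dot !plane_coordE !mulr0 addr0 => h.
    by apply: oppr_inj; rewrite oppr0 -h; ring.
  have neg q (n : int) : X q -> 0 <= n -> 0 <= - (n%:~R * dot a (emb R q - v)).
    by move=> Xq n0; rewrite oppr_ge0 mulr_ge0_le0 ?ler0z ?sup'.
  move=> /eqP; rewrite !paddr_eq0 ?addr_ge0 ?neg ?(ltW k0) // !oppr_eq0.
  by move=> /andP[/andP[/eqP -> /eqP ->] /eqP ->].
have [r r0 rE] := ray _ _ Xx ax (ltW k0).
have [t t0 tE] := ray _ _ Xy ay l0; have [u u0 uE] := ray _ _ Xz az m0.
move: comb; rewrite rE tE uE -!scalerDl => /eqP.
rewrite scaler_eq0 wv orbF !paddr_eq0 ?addr_ge0 //.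
move=> /andP[/andP[/eqP r00 _] _]; apply: emb_inj; rewrite pv.
move/eqP: rE; rewrite r00 scale0r scaler_eq0 intr_eq0 (gt_eqF k0) subr_eq0.
by move=> /eqP.
Qed.

(** At a turning point the edge towards the successor ends, so convexity makes the point a vertex of
    the hull. *)
Lemma convex_disk_turns (X : set pt) : convex_disk R X ->
  exists2 s, filled s X & turns_at_extreme s X.
Proof.
move=> [s bc hE]; have F := bounding_curve_filled bc; exists s => // v vs turn.
have s2 := filled_size F; have [Us Cs] := (filled_uniq F, filled_cycle F).
have [E [edgeE Ev En]] := edge_of_step Us Cs (ltnW s2) vs.
have : [set u | hull_vertex (R := R) X u] (emb R v).
  rewrite -hE; exists v => //; exists E => //.
  by apply: (turn_endpoint Us Cs s2 vs) turn => //; case: edgeE.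
by move=> /hull_vertex_extreme[p ext /emb_inj <-].
Qed.

End Hull.

(** * Parity of crossings in the Euclidean plane *)

Lemma near_seq (T : topologicalType) (U : eqType) (z0 : T) (s : seq U)
    (P : U -> T -> Prop) : (forall u, u \in s -> \forall z \near z0, P u z) ->
  \forall z \near z0, forall u, u \in s -> P u z.
Proof.
elim: s => [|u s IH] H; first by apply: nearW.
have H1 := H u (mem_head u s).
have H2 : \forall z \near z0, forall v, v \in s -> P v z.
  by apply: IH => v vs; apply: H; rewrite inE vs orbT.
near=> z => v; rewrite inE => /orP[/eqP ->|]; first by near: z.
by move: v; near: z.
Unshelve. all: by end_near. Qed.

(** Local constancy is known at points of [A] only, hence the interiors of the fibres: they are open
    and split [A] into relatively clopen parts. *)
Lemma connected_locally_constant (T : topologicalType) (A : set T)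
    (f : T -> bool) x y : connected A ->
  (forall z, A z -> \forall w \near z, f w = f z) -> A x -> A y -> f x = f y.
Proof.
move=> cA fA Ax Ay; pose B b := [set z | f z = b]°.
have AB b z : A z -> f z = b -> B b z.
  by move=> Az <-; apply: (fA z Az).
have BE b z : B b z -> f z = b by move=> /interior_subset.
have : A `&` B (f x) = A.
  apply: cA.
  - by exists x; split=> //; apply: AB.
  - by exists (B (f x)) => //; apply: open_interior.
  - exists (~` B (~~ f x)); first by apply/open_closedC/open_interior.
    apply/seteqP; split=> z [Az] /= h; split=> //.
      by move/BE: h => fz /BE; rewrite fz; case: (f x).
    apply: (AB) => //; apply: contrapT => nf; apply: h; apply: AB => //.
    by move: nf; case: (f z); case: (f x).
by move=> /seteqP[_ /(_ y Ay)[_ /BE]].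
Qed.

Section RealParity.
Variable R : realType.
Local Notation plane := (plane R).
Implicit Types (z : plane) (u v : pt) (s : seq pt).

Lemma plane_fst_cvg z0 : (fun z : plane => z.1 : R) z @[z --> z0] --> (z0.1 : R).
Proof. exact: cvg_fst. Qed.

Lemma plane_snd_cvg z0 : (fun z : plane => z.2 : R) z @[z --> z0] --> (z0.2 : R).
Proof. exact: cvg_snd. Qed.

Lemma near_sign (f : plane -> R) z0 : f z @[z --> z0] --> f z0 -> f z0 != 0 ->
  \forall z \near z0, (0 < f z) = (0 < f z0) /\ (f z < 0) = (f z0 < 0).
Proof.
move=> cf; rewrite neq_lt => /orP[f0|f0].
  near=> z; have fz : f z < 0 by near: z; apply: (cvgr_lt _ cf).
  by rewrite f0 fz !ltNge !ltW.
near=> z; have fz : 0 < f z by near: z; apply: (cvgr_gt _ cf).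
by rewrite f0 fz !ltNge !ltW.
Unshelve. all: by end_near. Qed.

(** The weak inequality makes crossings half-open in height, so that a vertex at the height of the
    ray is not counted twice. *)
Definition above (y : R) (u : pt) : bool := u.2%:~R <= y.

(** The cross product of [v - u] and [z - u], positive when [z] lies to the left of the directed
    line from [u] to [v]. *)
Definition side z u v : R :=
  (v.1%:~R - u.1%:~R) * (z.2 - u.2%:~R) - (v.2%:~R - u.2%:~R) * (z.1 - u.1%:~R).

(* The segment from [u] to [v] crosses the horizontal ray to the right of [z]: the
   sign of [side] that says so depends on whether the segment goes up or down. *)
Definition rcross z u v : bool :=
  (above z.2 u (+) above z.2 v) &&
  (if (u.2 < v.2)%R then 0 < side z u v else side z u v < 0).

Definition rparity s z : bool :=
  odd (count (fun u => rcross z u (next s u)) s).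

Lemma side_cvg z0 u v : side z u v @[z --> z0] --> side z0 u v.
Proof.
rewrite /side; apply: cvgB; apply: cvgM; try exact: cvg_cst.
  by apply: cvgB; [exact: plane_snd_cvg|exact: cvg_cst].
by apply: cvgB; [exact: plane_fst_cvg|exact: cvg_cst].
Qed.

Lemma near_above z0 u : z0.2 != u.2%:~R ->
  \forall z \near z0, above z.2 u = above z0.2 u.
Proof.
move=> h; have h0 : z0.2 - u.2%:~R != 0 by rewrite subr_eq0.
have cf : (z.2 - u.2%:~R : R) @[z --> z0] --> (z0.2 - u.2%:~R : R).
  by apply: cvgB; [exact: plane_snd_cvg|exact: cvg_cst].
have H := near_sign cf h0; near=> z.
have [_] : (0 < z.2 - u.2%:~R :> R) = (0 < z0.2 - u.2%:~R) /\
  (z.2 - u.2%:~R < 0 :> R) = (z0.2 - u.2%:~R < 0) by near: z; exact: H.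
by rewrite !subr_lt0 /above !leNgt => ->.
Unshelve. all: by end_near. Qed.

Lemma segmentP (a b z : plane) : segment a b z <->
  exists t : R, [/\ 0 <= t <= 1, z.1 = (1 - t) * a.1 + t * b.1 :> R
    & z.2 = (1 - t) * a.2 + t * b.2 :> R].
Proof.
split=> [[t t01 <-]|[t [t01 e1 e2]]]; first by exists t.
by exists t => //; apply: planeP; rewrite !plane_coordE ?e1 ?e2.
Qed.

(* The two parities differ by the coboundary of the test that compares the
   vertices at the height of [z0]. *)
Lemma rcross_near z0 u v : ~ segment (emb R u) (emb R v) z0 ->
  let g z w := (above z.2 w (+) above z0.2 w) && (z0.1 < w.1%:~R) in
  \forall z \near z0, rcross z u v (+) rcross z0 u v = g z u (+) g z v.
Proof.
move=> nseg g.
(* A horizontal step is never crossed; if it has the height of [z0], its ends lie on one side of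
   [z0], which is off the segment. *)
have [uv|uv] := eqVneq u.2 v.2.
  have r0 z : rcross z u v = false by rewrite /rcross /above uv addbb.
  have [h|h] := eqVneq z0.2 u.2%:~R; last first.
    near=> z; rewrite !r0 /g.
    have -> : above z.2 u = above z0.2 u by near: z; apply: near_above.
    have -> : above z.2 v = above z0.2 v by near: z; apply: near_above; rewrite -uv.
    by rewrite !addbb.
  near=> z; rewrite !r0 /g /above -uv.
  suff -> : (z0.1 < u.1%:~R) = (z0.1 < v.1%:~R) by rewrite !addbb.
  apply: contrapT => hlt; apply: nseg; apply/segmentP.
  have key (a b : R) : a <= z0.1 -> z0.1 < b ->
    exists t, 0 <= t <= 1 /\ z0.1 = (1 - t) * a + t * b.
    move=> az zb; have ab : 0 < b - a by lra.
    exists ((z0.1 - a) / (b - a)); split; last by field; rewrite gt_eqF.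
    by rewrite divr_ge0 ?ler_pdivrMr //=; lra.
  move: hlt; case: (ltP z0.1 u.1%:~R) => zu; case: (ltP z0.1 v.1%:~R) => zv hlt;
    try by case: hlt.
  - have [t [/andP[t0 t1] e]] := key _ _ zv zu.
    by exists (1 - t); split=> /=; [lra|rewrite e; ring|rewrite h -uv; ring].
  - have [t [/andP[t0 t1] e]] := key _ _ zu zv.
    by exists t; split=> /=; [lra|rewrite e; ring|rewrite h -uv; ring].
set c : R := v.2%:~R - u.2%:~R; have c0 : c != 0.
  by rewrite subr_eq0 eqr_int eq_sym.
have cE : (u.2 < v.2) = (0 < c) by rewrite subr_gt0 ltr_int.
(* Here [z0] is on the line but off the segment, so both ends lie strictly above or strictly below
   it. *)
have [s0|s0] := eqVneq (side z0 u v) 0.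
  pose t := (z0.2 - u.2%:~R) / c.
  have tc : z0.2 - u.2%:~R = t * c by rewrite /t divfK.
  have tc1 : z0.2 - v.2%:~R = (t - 1) * c by rewrite mulrBl -tc /c; ring.
  have e1 : z0.1 = (1 - t) * u.1%:~R + t * v.1%:~R.
    apply: (mulfI c0); apply/eqP; rewrite -subr_eq0 -[X in _ == X]oppr0 -s0.
    by rewrite /side -/c tc; apply/eqP; ring.
  have t01 : ~ (0 <= t <= 1).
    move=> t01; apply: nseg; apply/segmentP; exists t; split=> //=.
    by transitivity (u.2%:~R + t * c); [rewrite -tc; ring|rewrite /c; ring].
  have same : above z0.2 u = above z0.2 v.
    rewrite /above -[LHS]subr_ge0 -[RHS]subr_ge0 tc tc1.
    have [cp|cn] := ltP 0 c.
      rewrite !(pmulr_lge0 _ cp); apply/idP/idP => h; last by lra.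
      by rewrite leNgt; apply/negP => h'; apply: t01; lra.
    have {}cn : c < 0 by rewrite lt_neqAle c0.
    rewrite !(nmulr_lge0 _ cn); apply/idP/idP => h; first by lra.
    by rewrite leNgt; apply/negP => h'; apply: t01; lra.
  have zu : z0.2 != u.2%:~R.
    apply/eqP => e; apply: t01; move/eqP: tc; rewrite e subrr eq_sym mulf_eq0.
    by rewrite (negbTE c0) orbF => /eqP ->; rewrite lexx ler01.
  have zv : z0.2 != v.2%:~R.
    apply/eqP => e; apply: t01; move/eqP: tc1; rewrite e subrr eq_sym mulf_eq0.
    by rewrite (negbTE c0) orbF subr_eq0 => /eqP ->; rewrite lexx ler01.
  near=> z; rewrite /g /rcross.
  have -> : above z.2 u = above z0.2 u by near: z; apply: near_above.
  have -> : above z.2 v = above z0.2 v by near: z; apply: near_above.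
  by rewrite same !addbb.
have right_near : \forall z \near z0,
    (if u.2 < v.2 then 0 < side z u v else side z u v < 0) =
    (if u.2 < v.2 then 0 < side z0 u v else side z0 u v < 0).
  have H := near_sign (side_cvg (z0 := z0) (u := u) (v := v)) s0.
  near=> z.
  have [-> ->] : (0 < side z u v) = (0 < side z0 u v) /\
    (side z u v < 0) = (side z0 u v < 0) by near: z; exact: H.
  by [].
(* When [z0] has the height of an end with abscissa [x], the sign test becomes the horizontal
   comparison used in [g]. *)
have right_at (x : R) : side z0 u v = c * (x - z0.1) ->
    (if u.2 < v.2 then 0 < side z0 u v else side z0 u v < 0) = (z0.1 < x).
  move=> ->; rewrite cE -[RHS]subr_gt0; have [cp|cn] := ltP 0 c.
    by rewrite (pmulr_rgt0 _ cp).
  have {}cn : c < 0 by rewrite lt_neqAle c0.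
  by rewrite (nmulr_rlt0 _ cn).
have [zu|zu] := eqVneq z0.2 u.2%:~R.
  have zv : z0.2 != v.2%:~R by rewrite zu eqr_int.
  have r := @right_at u.1%:~R; near=> z; rewrite /g /rcross.
  have -> : above z.2 v = above z0.2 v by near: z; apply: near_above.
  have -> : (if u.2 < v.2 then 0 < side z u v else side z u v < 0) =
    (if u.2 < v.2 then 0 < side z0 u v else side z0 u v < 0).
    by near: z; exact: right_near.
  rewrite r; last by rewrite /side -/c zu; ring.
  by case: (z0.1 < _); case: (above z.2 u); case: (above z0.2 u); case: above.
have [zv|zv] := eqVneq z0.2 v.2%:~R.
  have r := @right_at v.1%:~R; near=> z; rewrite /g /rcross.
  have -> : above z.2 u = above z0.2 u by near: z; apply: near_above.
  have -> : (if u.2 < v.2 then 0 < side z u v else side z u v < 0) =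
    (if u.2 < v.2 then 0 < side z0 u v else side z0 u v < 0).
    by near: z; exact: right_near.
  rewrite r; last by rewrite /side -/c zv -/c; ring.
  by case: (z0.1 < _); case: (above z.2 v); case: (above z0.2 u); case: above.
near=> z; rewrite /g /rcross.
have -> : above z.2 u = above z0.2 u by near: z; apply: near_above.
have -> : above z.2 v = above z0.2 v by near: z; apply: near_above.
have -> : (if u.2 < v.2 then 0 < side z u v else side z u v < 0) =
  (if u.2 < v.2 then 0 < side z0 u v else side z0 u v < 0).
  by near: z; exact: right_near.
by rewrite !addbb.
Unshelve. all: by end_near. Qed.

Lemma rparity_near s z0 : uniq s -> ~ trace s z0 ->
  \forall z \near z0, rparity s z = rparity s z0.
Proof.
move=> Us ntr.
pose g z (w : pt) := (above z.2 w (+) above z0.2 w) && (z0.1 < w.1%:~R).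
have H : \forall z \near z0, forall u, u \in s ->
    rcross z u (next s u) (+) rcross z0 u (next s u) = g z u (+) g z (next s u).
  apply: near_seq => u us; apply: rcross_near => seg.
  by apply: ntr; exists u.
near=> z.
suff : rparity s z (+) rparity s z0 = false by do 2!case: (rparity s _).
rewrite -odd_count_addb -[RHS](odd_count_boundary Us (g z)).
congr (odd _); apply: eq_in_count; near: z; exact: H.
Unshelve. all: by end_near. Qed.

(** A crossed segment straddles the height of [z] and reaches to its right, which bounds [z] on
    three sides. Far to the left all straddling segments are crossed, and their number is even. *)
Lemma rparity_bounded s : uniq s -> exists M : R,
  forall z, rparity s z -> `|z.1| <= M /\ `|z.2| <= M.
Proof.
move=> Us; have [M hM] := bounded_seq s; exists M%:~R => z pz.
have hMR u : u \in s -> [/\ - M%:~R < u.1%:~R :> R, u.1%:~R < M%:~R :> R,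
    - M%:~R < u.2%:~R :> R & u.2%:~R < M%:~R :> R].
  by move=> /hM[h1 h2]; rewrite -!mulrNz !ltr_int; split; lia.
have: has (fun u => rcross z u (next s u)) s.
  by rewrite has_count; move: pz; rewrite /rparity; case: count.
move=> /hasP[u us cu]; have vs : next s u \in s by rewrite mem_next.
(* In this form the signs of the weights are known once the segment straddles the height of [z]. *)
have sideE (a b : pt) : side z a b = (z.2 - a.2%:~R) * (b.1%:~R - z.1) +
    (b.2%:~R - z.2) * (a.1%:~R - z.1) by rewrite /side; ring.
have straddle (a b : pt) : above z.2 a (+) above z.2 b ->
    if a.2 < b.2 then a.2%:~R <= z.2 < b.2%:~R else b.2%:~R <= z.2 < a.2%:~R.
  rewrite -(ltr_int R) /above.
  have [ha|ha] := leP a.2%:~R z.2; have [hb|hb] := leP b.2%:~R z.2;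
    have [hab|hab] := ltP (a.2%:~R : R) b.2%:~R; move=> //= _; lra.
have [[u1 u1' u2 u2'] [v1 v1' v2 v2']] := (hMR _ us, hMR _ vs).
have [zM z2] : z.1 < M%:~R /\ `|z.2| <= M%:~R.
  move/andP: cu => [/straddle]; rewrite sideE.
  by case: ifP => _ /andP[y1 y2] sgn; split; rewrite ?ler_norml; nra.
split=> //; rewrite ler_norml (ltW zM) andbT leNgt; apply/negP => zl.
suff: rparity s z = false by rewrite pz.
rewrite -(odd_count_boundary Us (above z.2)); congr (odd _).
apply: eq_in_count => a as_; have bs : next s a \in s by rewrite mem_next.
have [[a1 a1' a2 a2'] [b1 b1' b2 b2']] := (hMR _ as_, hMR _ bs).
rewrite /rcross; case h: (_ (+) _) => //=; have := straddle _ _ h; rewrite sideE.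
by case: ifP => _ /andP[y1 y2]; nra.
Qed.

End RealParity.

(** * The interior of the polygon near the corner *)

Section Strip.
Variables (R : realType) (s : seq pt) (X : set pt) (z : plane R).
Hypothesis F : filled s X.
Hypothesis below : forall u, X u -> 0 <= u.2.
Hypothesis row : forall u, X u -> u.2 = 0 -> u = (0, 0) \/ u = (1, 0).
Hypotheses (s01 : step s (0, 0) (1, 0)) (s12 : step s (1, 0) (0, 1))
  (s0b : step s (0, 0) (-1, 1)).
Hypotheses (z2 : 0 < z.2 < 1) (z12 : 0 < z.1 + z.2 < 1).

Let Us := filled_uniq F.

(** Each of the two axis points is consecutive to the other, which leaves it a single upward
    step. *)
Lemma strip_step_up u v : u \in s -> step s u v -> u.2 = 0 -> 0 < v.2 ->
  (u = (1, 0) /\ v = (0, 1)) \/ (u = (0, 0) /\ v = (-1, 1)).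
Proof.
move=> us st u0 v0; case: (row (filled_sub F us) u0) => uE; subst u.
  by right; case: (step_third F us s01 s0b isT st) v0 => ->.
left; have s10 : step s (1, 0) (0, 0) by rewrite stepC.
by case: (step_third F us s10 s12 isT st) v0 => ->.
Qed.

Lemma strip_step_cases u : u \in s -> let v := next s u in
  [\/ u.2 = 0 /\ v.2 = 0, 0 < u.2 /\ 0 < v.2,
    (u = (1, 0) /\ v = (0, 1)) \/ (u = (0, 0) /\ v = (-1, 1)) |
    (v = (1, 0) /\ u = (0, 1)) \/ (v = (0, 0) /\ u = (-1, 1))].
Proof.
move=> us v; have vs : v \in s by rewrite mem_next.
have st : step s u v by exact: step_next.
have := below (filled_sub F us); have := below (filled_sub F vs).
rewrite [0 <= v.2]le_eqVlt [0 <= u.2]le_eqVlt.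
move=> /orP[/eqP/esym v0|v0] /orP[/eqP/esym u0|u0].
- by constructor 1.
- by constructor 4; apply: strip_step_up; rewrite // stepC.
- by constructor 3; apply: strip_step_up.
- by constructor 2.
Qed.

(** The open parallelogram given by [z2] and [z12] lies between the two steps that leave the axis;
    every other segment has height 0 or height at least 1. *)
Lemma strip_off_trace : ~ trace s z.
Proof.
case=> u us /segmentP[t [/andP[t0 t1] /= e1 e2]].
case/andP: z2 => a1 a2; case/andP: z12 => b1 b2.
case: (strip_step_cases us).
- by move=> [u0 v0]; move: e2; rewrite u0 v0 => e2; lra.
- move=> [u0 v0]; have u1 : 1 <= u.2%:~R :> R by rewrite ler1z -gtz0_ge1.
  have v1 : 1 <= (next s u).2%:~R :> R by rewrite ler1z -gtz0_ge1.
  by nra.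
- by case=> -[uE vE]; rewrite vE uE /= in e1 e2; lra.
- by case=> -[vE uE]; rewrite vE uE /= in e1 e2; lra.
Qed.

(** Of the two steps that leave the axis, only the one joining [(1, 0)] and [(0, 1)] passes to the
    right of [z]. *)
Lemma strip_rparity : (2 < size s)%N -> (1, 0) \in s -> rparity s z.
Proof.
move=> s2 e1s; case/andP: z2 => a1 a2; case/andP: z12 => b1 b2.
suff -> : rparity s z = step s (1, 0) (0, 1) by [].
rewrite -odd_count_step //; congr (odd _); apply: eq_in_count => u us.
have ab0 (y : pt) : y.2 = 0 -> above z.2 y by rewrite /above => ->; apply: ltW.
have ab1 (y : pt) : 0 < y.2 -> above z.2 y = false.
  move=> y0; apply/negbTE; rewrite -ltNge; apply: lt_le_trans a2 _.
  by rewrite ler1z -gtz0_ge1.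
rewrite /rcross; case: (strip_step_cases us).
- move=> [u0 v0]; rewrite !ab0 //=; apply/esym/negbTE.
  by apply/negP => /orP[] /andP[/eqP E1 /eqP E2]; move: u0 v0; rewrite E2 E1.
- move=> [u0 v0]; rewrite !ab1 //=; apply/esym/negbTE.
  by apply/negP => /orP[] /andP[/eqP E1 /eqP E2]; move: u0 v0; rewrite E2 E1.
- case=> -[uE vE]; rewrite vE uE.
    by rewrite (ab0 (1, 0)) // (ab1 (0, 1)) //= /side /= /eq_op /=; lra.
  rewrite (ab0 (0, 0)) // (ab1 (-1, 1)) //= /side /=.
  by apply/negbTE; rewrite -leNgt; lra.
- case=> -[vE uE]; rewrite vE uE.
    by rewrite (ab0 (1, 0)) // (ab1 (0, 1)) //= /side /= /eq_op /= eqxx; lra.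
  rewrite (ab0 (0, 0)) // (ab1 (-1, 1)) //= /side /=.
  by apply/negbTE; rewrite -leNgt; lra.
Qed.

End Strip.

Section RealFrame.
Variables (R : realType) (o : pt) (w a b : bool).
Local Notation plane := (plane R).
Local Notation T := (frame o w a b).
Local Notation T' := (unframe o w a b).

Definition frameR (z : plane) : plane :=
  let x := if a then o.1%:~R - z.1 else z.1 - o.1%:~R in
  let y := if b then o.2%:~R - z.2 else z.2 - o.2%:~R in
  if w then (y, x) else (x, y).

Lemma frameR_emb p : frameR (emb R p) = emb R (T p).
Proof.
by rewrite /frameR /emb /frame; case: w; case: a; case: b; rewrite /= !rmorphB.
Qed.

Lemma segment_frameR u v z :
  segment (frameR u) (frameR v) (frameR z) <-> segment u v z.
Proof.
split=> /segmentP[t [t01 e1 e2]]; apply/segmentP; exists t; split=> //;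
  move: e1 e2; rewrite /frameR; case: w; case: a; case: b => /= e1 e2; lra.
Qed.

Lemma trace_frameR s z : uniq s -> trace (map T s) (frameR z) <-> trace s z.
Proof.
move=> Us; split=> [[p]|[p ps seg]].
  rewrite mem_map_frame => ps; rewrite -(unframeK o w a b p).
  rewrite (next_map (can_inj (frameK o w a b))) // -!frameR_emb.
  by move=> /segment_frameR seg; exists (T' p).
exists (T p); first by rewrite (mem_map (can_inj (frameK o w a b))).
rewrite (next_map (can_inj (frameK o w a b))) // -!frameR_emb.
exact/segment_frameR.
Qed.

Lemma frameR_cvg z0 : frameR z @[z --> z0] --> frameR z0.
Proof.
have h1 (c : R) : (c - (z.1 : R)) @[z --> z0] --> (c - z0.1 : R).
  by apply: cvgB; [exact: cvg_cst|exact: plane_fst_cvg].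
have h2 (c : R) : ((z.1 : R) - c) @[z --> z0] --> (z0.1 - c : R).
  by apply: cvgB; [exact: plane_fst_cvg|exact: cvg_cst].
have h3 (c : R) : (c - (z.2 : R)) @[z --> z0] --> (c - z0.2 : R).
  by apply: cvgB; [exact: cvg_cst|exact: plane_snd_cvg].
have h4 (c : R) : ((z.2 : R) - c) @[z --> z0] --> (z0.2 - c : R).
  by apply: cvgB; [exact: plane_snd_cvg|exact: cvg_cst].
rewrite /frameR; case: w; case: a; case: b => /=.
- exact: (cvg_pair (h3 _) (h1 _)).
- exact: (cvg_pair (h4 _) (h1 _)).
- exact: (cvg_pair (h3 _) (h2 _)).
- exact: (cvg_pair (h4 _) (h2 _)).
- exact: (cvg_pair (h1 _) (h3 _)).
- exact: (cvg_pair (h1 _) (h4 _)).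
- exact: (cvg_pair (h2 _) (h3 _)).
- exact: (cvg_pair (h2 _) (h4 _)).
Qed.

(** Parity is constant on the component of [z] off the trace, and odd parity occurs only in a
    bounded region. *)
Lemma inside_frameR s z : uniq s -> ~ trace s z ->
  rparity (map T s) (frameR z) -> inside s z.
Proof.
move=> Us ntr pz; split=> //.
have UT : uniq (map T s) by rewrite map_inj_uniq //;
  apply: can_inj (@frameK o w a b).
have [M hM] := @rparity_bounded R _ UT.
pose C := connected_component (~` trace s) z.
have CM y : C y -> `|y| <= M + (`|o.1%:~R| + `|o.2%:~R|).
  move=> Cy.
  have : rparity (map T s) (frameR z) = rparity (map T s) (frameR y).
    apply: (connected_locally_constant (A := C)
      (f := fun y => rparity (map T s) (frameR y))) => //.
    - exact: component_connected.
    - move=> u Cu; have ntu : ~ trace s u by exact: connected_component_sub Cu.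
      have ntT : ~ trace (map T s) (frameR u) by move=> tu; apply/ntu/trace_frameR.
      exact: (frameR_cvg (rparity_near UT ntT)).
    - exact: connected_component_refl.
  rewrite pz => /esym/hM[]; rewrite prod_normE ge_max /frameR.
  have n1 := ler_norm (o.1%:~R : R); have n1' := ler_norm (- o.1%:~R : R).
  have n2 := ler_norm (o.2%:~R : R); have n2' := ler_norm (- o.2%:~R : R).
  rewrite normrN in n1'; rewrite normrN in n2'.
  rewrite !ler_norml; case: w; case: a; case: b => /= /andP[h1 h2] /andP[h3 h4];
  by apply/andP; split; apply/andP; split; lra.
exists (M + (`|o.1%:~R| + `|o.2%:~R|)); split; first exact: num_real.
by move=> N MN y Cy; apply: le_trans (CM y Cy) (ltW MN).
Qed.

Lemma frameR_combine p x y (A B : R) :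
  frameR (emb R p + A *: emb R (x - p) + B *: emb R (y - p)) =
  emb R (T p) + A *: emb R (T x - T p) + B *: emb R (T y - T p).
Proof.
apply: planeP; rewrite !plane_coordE /frameR /frame /emb;
  case: w; case: a; case: b; rewrite /= ?plane_coordE /= !rmorphB /=;
    rewrite /GRing.scale /=; ring.
Qed.

Lemma dot_frame p x y :
  dot (emb R (T x - T p)) (emb R (T y - T p)) = dot (emb R (x - p)) (emb R (y - p)).
Proof.
rewrite /dot /frame /emb; case: w; case: a; case: b; rewrite /= !rmorphB /=; ring.
Qed.

End RealFrame.

(** * Thickness at the corner *)

(** The argument of [acos] is the cosine of the angle between [(1, 0)] and [(- i, i)]. The square
    root of 2 appears as the inverse of the sine of [pi / 4]. *)
Lemma angle_obtuse (R : realType) (i : R) : 0 < i ->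
  acos (- i / (Num.sqrt 1 * Num.sqrt (i * i + i * i))) = 3 * pi / 4.
Proof.
move=> i0; have p0 := pi_gt0 R; set q : R := pi / 4.
have sq0 : 0 < sin q by apply: sin_gt0_pi; rewrite /q; apply/andP; split; lra.
have cq0 : 0 < cos q by apply: cos_gt0_pihalf; rewrite /q; apply/andP; split; lra.
have sq : 2 * sin q ^+ 2 = 1.
  have := cos2Dsin2 q; have := cos_mulr2n q.
  have -> : q *+ 2 = pi / 2 by rewrite /q -mulr_natr; field.
  rewrite cos_pihalf => h1 h2; rewrite -mulr_natl in h1; lra.
have -> : Num.sqrt (i * i + i * i) = i / sin q.
  have -> : i * i + i * i = (i / sin q) ^+ 2.
    by rewrite expr_div_n; apply: (mulIf (x := sin q ^+ 2)); 
      rewrite ?divfK ?expf_eq0 ?gt_eqF //; move: sq; nra.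
  by rewrite sqrtr_sqr ger0_norm // divr_ge0 // ltW.
rewrite sqrtr1 mul1r.
have -> : - i / (i / sin q) = - sin q by field; rewrite !gt_eqF.
have -> : - sin q = cos (3 * pi / 4).
  by rewrite -cosDpihalf; congr cos; rewrite /q; field.
by rewrite cosK // in_itv /=; apply/andP; split; lra.
Qed.

Lemma edge_of_adjacent (s : seq pt) u v : uniq s -> cycle (adjeq c2) s ->
  (1 < size s)%N -> u \in s -> v \in s -> step s u v ->
  exists E, [/\ edge s E, E u & E v].
Proof.
move=> Us Cs s1 us vs /orP[] /eqP <-; first exact: edge_of_step.
by have [E [h1 h2 h3]] := edge_of_step Us Cs s1 vs; exists E.
Qed.

Lemma edge_sub (s : seq pt) E z : edge s E -> E z -> z \in s.
Proof. by move=> [[_ [i [n ->]]] _] /= /mem_take; rewrite mem_rot. Qed.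

Lemma edge_line (s : seq pt) E (x y z : pt) : edge s E -> E x -> E y -> E z ->
  (y.2 - x.2) * (z.1 - x.1) = (y.1 - x.1) * (z.2 - x.2).
Proof.
move=> [[[_ [a [b [c [ab line]]]] _] _] _] Ex Ey Ez.
apply: (@line_proportional a b (y.1 - x.1, y.2 - x.2) (z.1 - x.1, z.2 - x.2))
  => //=.
  by rewrite !mulrBr; have := line _ Ex; have := line _ Ey; lia.
by rewrite !mulrBr; have := line _ Ex; have := line _ Ez; lia.
Qed.

Section ThickCorner.
Variables (R : realType) (o : pt) (w a b : bool) (s : seq pt) (X : set pt).
Local Notation T := (frame o w a b).
Local Notation T' := (unframe o w a b).
Local Notation TR := (frameR (R := R) o w a b).
Hypothesis F : filled s X.
Hypothesis thickX : forall E F p, interior_angle s E F p (3 * pi / 4 : R) ->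
  obtuse_thick R X E F p.
Hypotheses (ext0 : extreme (T' @^-1` X) (0, 0)) (Xe1 : X (T' (1, 0)))
  (Xe2 : X (T' (0, 1))).
Hypothesis below : forall z, X (T' z) -> 0 <= z.2.
Hypothesis row : forall z, X (T' z) -> z.2 = 0 -> z = (0, 0) \/ z = (1, 0).
Hypothesis far : ~ X (T' (2, 1)).

Let Us := filled_uniq F.
Let Cs := filled_cycle F.

Lemma step_frame u v : step (map T s) u v = step s (T' u) (T' v).
Proof.
rewrite /step -{1 2}(unframeK o w a b u) -{1 2}(unframeK o w a b v).
rewrite !(next_map (can_inj (frameK o w a b))) //.
by rewrite !(can_eq (frameK o w a b)).
Qed.

Lemma edge_line_frame E (x y z : pt) : edge s E -> E x -> E y -> E z ->
  ((T y).2 - (T x).2) * ((T z).1 - (T x).1) =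
  ((T y).1 - (T x).1) * ((T z).2 - (T x).2).
Proof.
move=> eE Ex Ey Ez; have := edge_line eE Ex Ey Ez.
by rewrite /frame; case: w; case: a; case: b => /=; lia.
Qed.

Lemma thick_corner : X (T' (1, 1)).
Proof.
apply: contrapT => Xq.
have F' := filled_frame o w a b F.
have [s01 s12 s0b] := strip_steps F' ext0 Xe1 Xe2 Xq below row far.
have [m0 m1 m2] := corner_mem F' ext0 Xe1 Xe2 Xq.
have mb : (-1, 1) \in map T s.
  by move: s0b; rewrite stepE ?(filled_uniq F') // => /orP[] /eqP ->;
    rewrite ?mem_next ?mem_prev.
have s2 := filled_size F; have s2' := filled_size F'.
set p := T' (0, 0).
have Tp : T p = (0, 0) by rewrite unframeK.
have [E [eE Ep Ex]] : exists E, [/\ edge s E, E p & E (T' (1, 0))].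
  apply: edge_of_adjacent => //; first exact: ltnW.
  - by rewrite -mem_map_frame.
  - by rewrite -mem_map_frame.
  - by rewrite -step_frame.
have [G [eG Gp Gx]] : exists G, [/\ edge s G, G p & G (T' (-1, 1))].
  apply: edge_of_adjacent => //; first exact: ltnW.
  - by rewrite -mem_map_frame.
  - by rewrite -mem_map_frame.
  - by rewrite -step_frame.
have XT z : z \in s -> X (T' (T z)) by rewrite frameK; apply: (filled_sub F).
have Ez z : E z -> z <> p -> T z = (1, 0).
  move=> hz zp; have := edge_line_frame eE Ep Ex hz.
  rewrite Tp unframeK /= => h.
  have [] := row (XT _ (edge_sub eE hz)); [by clear -h; lia| |by []].
  by rewrite -Tp => /(can_inj (frameK o w a b)).
have Gz z : G z -> z <> p -> exists2 i : int, 0 < i & T z = (- i, i).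
  move=> hz zp; have := edge_line_frame eG Gp Gx hz.
  rewrite Tp unframeK /= => h; have h0 := below (XT _ (edge_sub eG hz)).
  exists (T z).2; last by apply: ptP; clear -h; rewrite /=; lia.
  rewrite lt_neqAle h0 andbT; apply/eqP => e0; apply: zp.
  by apply: (can_inj (frameK o w a b)); rewrite Tp; apply: ptP; clear -h e0;
    rewrite /=; lia.
(* The edge [E] has only [(1, 0)] besides the corner, and [G] runs along the direction [(-1, 1)], so
   the sector lies in this wedge. *)
have sectorP z : sector p E G z -> 0 < (TR z).2 /\ 0 < (TR z).1 + (TR z).2.
  move=> [x [y [A [B [[hx /eqP xp] [hy /eqP yp] A0 B0 ->]]]]].
  rewrite frameR_combine Tp (Ez x hx xp); have [i i0 ->] := Gz y hy yp.
  rewrite !plane_coordE /= !subr0 rmorphN rmorph0 rmorph1.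
  have iR : 0 < i%:~R :> R by rewrite ltr0z.
  have Bi : 0 < B * i%:~R by rewrite mulr_gt0.
  by split; lra.
have angle : interior_angle s E G p (3 * pi / 4 : R).
  split=> //.
  - apply/seteqP; split=> [z [hE hG]|z ->]; last by split.
    apply: contrapT => /= zp; have := Ez z hE zp; have [i i0 ->] := Gz z hG zp.
    by case; clear -i0; lia.
  - move=> x y hx hy /eqP xp /eqP yp; have := Ez x hx xp; have [i i0] := Gz y hy yp.
    move=> Ty Tx; rewrite /angle -(@dot_frame R o w a b p x y).
    rewrite -(@dot_frame R o w a b p x x) -(@dot_frame R o w a b p y y).
    rewrite Tx Ty Tp /dot /=.
    rewrite !subr0 rmorph0 rmorph1 rmorphN mulrNN !mul0r !mul1r !addr0.
    by apply: angle_obtuse; rewrite ltr0z.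
  - have Tp0 : TR (emb R p) = (0, 0) by rewrite frameR_emb Tp.
    (* Coordinates below one half keep the wedge inside the parallelogram where the parity is
       odd. *)
    have half : 0 < 1 / 2 :> R by lra.
    have near1 : \forall z \near emb R p, (TR z).1 < 1 / 2.
      have H : \forall z \near TR (emb R p), z.1 < 1 / 2 :> R.
        by apply: (cvgr_lt _ (@plane_fst_cvg R _)); rewrite Tp0.
      exact: (frameR_cvg H).
    have near2 : \forall z \near emb R p, (TR z).2 < 1 / 2.
      have H : \forall z \near TR (emb R p), z.2 < 1 / 2 :> R.
        by apply: (cvgr_lt _ (@plane_snd_cvg R _)); rewrite Tp0.
      exact: (frameR_cvg H).
    near=> z => /sectorP[z2 z12].
    have h1 : (TR z).1 < 1 / 2 by near: z; exact: near1.
    have h2 : (TR z).2 < 1 / 2 by near: z; exact: near2.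
    have h3 : 0 < (TR z).2 < 1 by apply/andP; split; lra.
    have h4 : 0 < (TR z).1 + (TR z).2 < 1 by apply/andP; split; lra.
    apply: (@inside_frameR R o w a b) => //.
      by move=> /trace_frameR - /(_ o w a b Us); apply: (strip_off_trace F').
    exact: (strip_rparity F').
(* The only diagonal neighbour of the corner inside the wedge is [(1, 1)]. *)
have [c [_ [Xc _ [/sectorP[h2 h12] _] diag _]]] := thickX angle.
apply: Xq; suff <- : c = T' (1, 1) by [].
apply: (can_inj (frameK o w a b)); rewrite unframeK.
move: h2 h12; rewrite frameR_emb /emb /= -rmorphD /= !ltr0z => h2 h12.
move: diag; rewrite /Defs.diagonal -(adj_frame o w a b c2 p c) -(adj_frame o w
  a b c1 p c) Tp.
rewrite /adj !pt_eqE /=.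
move: (T c) h2 h12 => [x y] /= y0 xy d; clear -y0 xy d.
by apply: ptP => /=; lia.
Unshelve. all: by end_near. Qed.

End ThickCorner.

(** * Pushing an extreme point *)

Lemma corner_strip s X : filled s X -> turns_at_extreme s X ->
  extreme X (0, 0) -> X (1, 0) -> X (0, 1) -> ~ X (1, 1) ->
  step s (0, 0) (1, 0) ->
  [/\ forall z, X z -> 0 <= z.2,
      forall z, X z -> z.2 = 0 -> z = (0, 0) \/ z = (1, 0) & ~ X (2, 1)].
Proof.
move=> F tX ext0 Xe1 Xe2 Xq; have Us := filled_uniq F.
have key t : filled t X -> turns_at_extreme t X -> next t (0, 0) = (1, 0) ->
    [/\ forall z, X z -> 0 <= z.2,
      forall z, X z -> z.2 = 0 -> z = (0, 0) \/ z = (1, 0) & ~ X (2, 1)].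
  move=> Ft tt n0; split.
  - exact: (strip_below Ft ext0 Xe1 Xe2 Xq tt n0).
  - exact: (strip_row Ft ext0 Xe1 Xe2 Xq tt n0).
  - exact: (strip_far Ft ext0 Xe1 Xe2 Xq tt n0).
rewrite stepE // => /orP[] /eqP/esym E; first exact: key F tX E.
by apply: key (filled_rev F) (turns_rev Us tX) _; rewrite next_rev.
Qed.

Lemma thick_convex_corner (R : realType) (X : set pt) (p : pt) (a b : bool) :
  thick R X -> convex_disk R X -> extreme X p ->
  X (unframe p false a b (1, 0)) -> X (unframe p false a b (0, 1)) ->
  X (unframe p false a b (1, 1)).
Proof.
move=> [t bt [_ _ thickt]] cX extp X1 X2; apply: contrapT => Xq.
have [s F tX] := convex_disk_turns cX; have Us := filled_uniq F.
have ext w : extreme (unframe p w a b @^-1` X) (0, 0).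
  have <- : frame p w a b p = (0, 0).
    by rewrite /frame; apply: ptP; case: w; case: a X1 X2 Xq; case: b;
      rewrite /= subrr.
  exact: extreme_frame.
(* The candidates [(1, -1)] and [(-1, 1)] are opposite, hence not both in [X], while the two
   neighbours on the curve differ. So one of these is [(1, 0)] or [(0, 1)], and [w] exchanges the
   axes in the second case. *)
have [w sw] : exists w, step (map (frame p w a b) s) (0, 0) (1, 0).
  pose F0 := filled_frame p false a b F.
  suff : step (map (frame p false a b) s) (0, 0) (1, 0) \/
      step (map (frame p false a b) s) (0, 0) (0, 1).
    move=> [st|st]; [by exists false|exists true].
    by rewrite (step_frame _ _ _ _ F) in st; rewrite (step_frame _ _ _ _ F).
  have [m0 _ _] := corner_mem F0 (ext false) X1 X2 Xq.
  have := next_neq_prev (filled_uniq F0) (filled_size F0) m0.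
  have sn := step_next (map (frame p false a b) s) (0, 0).
  have sp := step_prev (0, 0) (filled_uniq F0).
  have anti := corner_anti (ext false).
  have Xn : X (unframe p false a b (next (map (frame p false a b) s) (0, 0))).
    by apply: (filled_sub F0); rewrite mem_next.
  have Xp : X (unframe p false a b (prev (map (frame p false a b) s) (0, 0))).
    by apply: (filled_sub F0); rewrite mem_prev.
  have [E|E|E|E] := corner_next F0 (ext false) X1 X2 Xq; rewrite E in sn Xn *.
  - by left.
  - by right.
  - have [E'|E'|E'|E'] := corner_prev F0 (ext false) X1 X2 Xq;
      rewrite E' in sp Xp *; by [left|right|move/eqP|case: (anti _ Xn)].
  - have [E'|E'|E'|E'] := corner_prev F0 (ext false) X1 X2 Xq;
      rewrite E' in sp Xp *; by [left|right|move/eqP|case: (anti _ Xn)].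
have [X1w X2w Xqw] : [/\ X (unframe p w a b (1, 0)), X (unframe p w a b (0, 1))
    & ~ X (unframe p w a b (1, 1))] by case: w {sw}.
have [below row far] := corner_strip (filled_frame p w a b F)
  (turns_frame Us tX) (ext w) X1w X2w Xqw sw.
exact: Xqw (thick_corner (bounding_curve_filled bt) thickt (ext w) X1w X2w
  below row far).
Qed.

Lemma connected_closed (X : set pt) (P : pred pt) (x : pt) : kconnected c1 X ->
  X x -> P x -> (forall y z, X y -> X z -> P y -> adj c1 y z -> P z) ->
  forall y, X y -> P y.
Proof.
move=> conn Xx Px cl y Xy; have := conn x y Xx Xy.
move=> /(kjoined_invariant (f := P)) <- // z w Xz Xw a.
by apply/idP/idP => h; [apply: (cl z)|apply: (cl w); rewrite // adjC].
Qed.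

Lemma filled_large s X (u v : pt) : filled s X ->
  exists z, [/\ X z, z != u & z != v].
Proof.
move=> F; have [z Xz zs] := filled_inner F.
have X1 : X (z.1 + 1, z.2).
  by apply: (filled_adj F Xz zs); rewrite /adj !pt_eqE /=; lia.
have X2 : X (z.1, z.2 + 1).
  by apply: (filled_adj F Xz zs); rewrite /adj !pt_eqE /=; lia.
apply: contrapT => H.
have no (y : pt) : X y -> y = u \/ y = v.
  move=> Xy; apply: contrapT => n; apply: H; exists y; split=> //.
    by apply/eqP => e; apply: n; left.
  by apply/eqP => e; apply: n; right.
have n01 : z <> (z.1 + 1, z.2) by move/(congr1 fst) => /=; lia.
have n02 : z <> (z.1, z.2 + 1) by move/(congr1 snd) => /=; lia.
have n12 : (z.1 + 1, z.2) <> (z.1, z.2 + 1) by case; lia.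
case: (no _ Xz) => h0; case: (no _ X1) => h1; case: (no _ X2) => h2;
  by [apply: n01; exact: etrans h0 (esym h1)|apply: n02; exact: etrans h0 (esym h2)
    |apply: n12; exact: etrans h1 (esym h2)].
Qed.

(* Sending [p] to [q] and fixing the other points is a continuous map. *)
Definition pushable (X : set pt) (p q : pt) : Prop :=
  [/\ X q, ~~ adjeq c1 p q & forall y, X y -> adj c1 p y -> adjeq c1 q y].

(** If [n] had no neighbour in [X] other than [p], these two points would exhaust the connected set
    [X], which is too large; so [p] is pushed to such a neighbour. The choice [n := p] covers a
    point without neighbours. *)
Lemma pushable_leaf s X p n : filled s X -> kconnected c1 X -> X p ->
  (forall y, X y -> adj c1 p y -> y = n) -> exists q, pushable X p q.
Proof.
move=> F conn Xp only; apply: contrapT => H.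
have [z [Xz zp zn]] := filled_large p n F.
pose P (y : pt) := (y == p) || (y == n).
suff cl y x : X y -> X x -> P y -> adj c1 y x -> P x.
  have := connected_closed conn Xp _ cl Xz.
  by rewrite /P eqxx (negbTE zp) (negbTE zn) => /(_ isT).
move=> Xy Xx /orP[/eqP ->|/eqP yn] a.
  by rewrite /P (only x) ?eqxx ?orbT.
subst y; apply/negPn/negP => /norP[xp xn]; apply: H; exists x; split=> //.
  apply/negP => /orP[/eqP e|a']; first by rewrite e eqxx in xp.
  by rewrite (only x Xx a') eqxx in xn.
by move=> u Xu /(only u Xu) ->; rewrite /adjeq adjC a orbT.
Qed.

Lemma adj1_cases (o y : pt) (a b : bool) : adj c1 o y ->
  (y = unframe o false a b (1, 0) \/ y = unframe o false a b (-1, 0)) \/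
  (y = unframe o false a b (0, 1) \/ y = unframe o false a b (0, -1)).
Proof.
rewrite /adj !pt_eqE /unframe => h.
have : (y.1 = o.1 + 1 /\ y.2 = o.2 \/ y.1 = o.1 - 1 /\ y.2 = o.2) \/
  (y.1 = o.1 /\ y.2 = o.2 + 1 \/ y.1 = o.1 /\ y.2 = o.2 - 1) by lia.
case: y {h} => y1 y2 /=.
by case: a; case: b => /= -[[[-> ->]|[-> ->]]|[[-> ->]|[-> ->]]];
  rewrite ?addr0 ?subr0 ?opprK; tauto.
Qed.

Lemma thick_convex_pushable (R : realType) (X : set pt) p : digital_disk X ->
  thick R X -> convex_disk R X -> kconnected c1 X -> extreme X p ->
  exists q, pushable X p q.
Proof.
move=> [s /bounding_curve_filled F] tX cX conn extp; have Xp := proj1 extp.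
have ext a b : extreme (unframe p false a b @^-1` X) (0, 0).
  have <- : frame p false a b p = (0, 0).
    by rewrite /frame; apply: ptP; case: a; case: b; rewrite /= subrr.
  exact: extreme_frame.
(* The signs [a] and [b] point to a horizontal and a vertical neighbour of [p] in [X], where these
   exist. *)
have [[a Xa]|Nh] := pselect (exists a, X (unframe p false a false (1, 0)));
have [[b Xb]|Nv] := pselect (exists b, X (unframe p false false b (0, 1))).
- have {}Xa : X (unframe p false a b (1, 0)).
    by move: Xa; rewrite /unframe /=; case: b {Xb} => //; rewrite addr0 subr0.
  have {}Xb : X (unframe p false a b (0, 1)).
    by move: Xb; rewrite /unframe /=; case: a {Xa} => //; rewrite addr0 subr0.
  have Xq := thick_convex_corner tX cX extp Xa Xb.
  exists (unframe p false a b (1, 1)); split=> //.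
    rewrite /adjeq /adj !pt_eqE /unframe /=; case: a {Xa Xb Xq}; case: b => /=; lia.
  move=> y Xy /(adj1_cases a b) [[yE|yE]|[yE|yE]]; subst y.
  - rewrite /adjeq /adj !pt_eqE /unframe /=; case: a {Xa Xb Xq Xy}; case: b =>
    /=; lia.
  - by case: (corner_left (ext a b) Xa (x := -1)).
  - rewrite /adjeq /adj !pt_eqE /unframe /=; case: a {Xa Xb Xq Xy}; case: b =>
    /=; lia.
  - by case: (corner_below (ext a b) Xb (x := -1)).
- apply: (pushable_leaf (n := unframe p false a false (1, 0)) F conn Xp).
  move=> y Xy /(adj1_cases a false) [[//|yE]|[yE|yE]]; subst y.
  - by case: (corner_left (ext a false) Xa (x := -1)).
  - case: Nv; exists false; move: Xy; rewrite /unframe /=.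
    by case: a {Xa}; rewrite /= ?addr0 ?subr0.
  - case: Nv; exists true; move: Xy; rewrite /unframe /=.
    by case: a {Xa}; rewrite /= ?addr0 ?subr0.
- apply: (pushable_leaf (n := unframe p false false b (0, 1)) F conn Xp).
  move=> y Xy /(adj1_cases false b) [[yE|yE]|[//|yE]]; subst y.
  - case: Nh; exists false; move: Xy; rewrite /unframe /=.
    by case: b {Xb}; rewrite /= ?addr0 ?subr0.
  - case: Nh; exists true; move: Xy; rewrite /unframe /=.
    by case: b {Xb}; rewrite /= ?addr0 ?subr0.
  - by case: (corner_below (ext false b) Xb (x := -1)).
- apply: (pushable_leaf (n := p) F conn Xp).
  move=> y Xy /(adj1_cases false false) [[yE|yE]|[yE|yE]]; subst y; exfalso.
  - by apply: Nh; exists false.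
  - by apply: Nh; exists true; move: Xy; rewrite /unframe /= ?addr0 ?subr0.
  - by apply: Nv; exists false.
  - by apply: Nv; exists true; move: Xy; rewrite /unframe /= ?addr0 ?subr0.
Qed.

(** Joinedness ensures that [dist] is the length of an actual path and not the default 0. *)
Lemma dist_le1 k X x y : kjoined k X x y -> (dist k X x y <= 1)%N -> adjeq k x y.
Proof.
move=> [n xy].
have ex : exists n, `[< kpath k X x y n >] by exists n; apply/asboolP.
have : [set n | kpath k X x y n /\ forall m, kpath k X x y m -> (n <= m)%N] !=set0.
  exists (ex_minn ex); case: ex_minnP => m /asboolP h1 h2; split=> // m' h.
  exact/h2/asboolP.
move=> /(xgetPex 0%N)[]; rewrite -/(dist k X x y).
move: (dist k X x y) => d [q [sq pq lq _]] _; case: q sq pq lq => [|z [|]] //=.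
- by move=> _ _ ->; rewrite /adjeq eqxx.
- by move=> _ /andP[h _] <-.
- by move=> z' q <-.
Qed.

Theorem theorem6p1 (R : realType) (X : set pt) (S : seq pt) (p0 : plane R)
  (A : set pt) :
  digital_disk X -> thick R X -> convex_disk R X ->
  minimal_bounding_curve S X ->
  hull_vertex X p0 ->
  cold_set c1 X A ->
  exists2 a : pt, A a & emb R a = p0.
Proof.
move=> dX tX cX _ /hull_vertex_extreme[p extp <-] [conn AX cold].
exists p => //; apply: contrapT => nAp; have Xp := proj1 extp.
have [q [Xq npq near]] := thick_convex_pushable dX tX cX conn extp.
pose f (z : pt) := if z == p then q else z.
have fc : kcontinuous c1 X f.
  split=> [x Xx|x y Xx Xy xy]; first by rewrite /f; case: ifP.
  rewrite /f; have [xp|_] := eqVneq x p; have [yp|_] := eqVneq y p.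
  - by rewrite /adjeq eqxx.
  - by apply: near => //; rewrite -xp.
  - by rewrite adjeqC; apply: near => //; rewrite -yp adjC.
  - by rewrite /adjeq xy orbT.
have fA x : A x -> f x = x.
  by rewrite /f; case: eqP => // -> /nAp.
have := cold f fc fA p Xp; rewrite /f eqxx => /(dist_le1 (conn _ _ Xp Xq)).
by rewrite (negbTE npq).
Qed.
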